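(* Let $G$ be a second-countable, locally compact, Hausdorff and étale groupoid. Suppose that the stability subgroups of $G$ are abelian and vary continuously. Let $\mathcal R=G/\mathcal A$ be the quotient groupoid of $G$ by its isotropy groupoid $\mathcal A$. Then the transformation groupoid $\widehat{\mathcal A}\rtimes\mathcal R$ is étale. Moreover, if $d\in\mathbf N$ and $\mathcal R$ has dynamic asymptotic dimension at most $d$, then $\widehat{\mathcal A}\rtimes\mathcal R$ has dynamic asymptotic dimension at most $d$.
   Context: $\mathbf N=\{0,1,2,\dots\}$. For a topological groupoid $G$ with unit space $G^{(0)}$, $r(g)=gg^{-1}$, $s(g)=g^{-1}g$; $G$ is étale if $r$ is a local homeomorphism. The stability subgroup at $u\in G^{(0)}$ is $\mathcal A_u=\{\alpha\in G:r(\alpha)=u=s(\alpha)\}$. The stability subgroups vary continuously if $u\mapsto\mathcal A_u$ is continuous from $G^{(0)}$ into the space of closed subgroups of $G$ with the Fell topology; this is equivalent to $\mathcal A$ having a Haar system. The isotropy groupoid is $\mathcal A=\{\alpha\in G: r(\alpha)=s(\alpha)\}$, acting on the right of $G$ by multiplication. $\mathcal R=G/\mathcal A$ is the quotient with the quotient topology and induced groupoid structure, with $\mathcal R^{(0)}=G^{(0)}$; write $\dot\gamma$ for the class of $\gamma\in G$. Under the hypotheses $\mathcal R$ is a locally compact Hausdorff étale principal groupoid. $\widehat{\mathcal A}$ is the spectrum of the separable commutative $C^*$-algebra $C^*(\mathcal A,\nu)$, $\nu$ a Haar system on $\mathcal A$. As a set $\widehat{\mathcal A}=\{(\chi,u):u\in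 G^{(0)},\chi\in\widehat{\mathcal A_u}\}$ with $(\chi,u)(f)=\int_{\mathcal A_u}\chi(a)f(a)\,d\nu^u(a)$ for $f\in C_c(\mathcal A)$. $\mathcal R$ acts on the right of $\widehat{\mathcal A}$ with anchor map $(\chi,u)\mapsto u$ by $(\chi,u)\cdot\dot\gamma=(\chi\cdot\gamma,s(\gamma))$ when $r(\gamma)=u$, where $(\chi\cdot\gamma)(a)=\chi(\gamma a\gamma^{-1})$ for $a\in\mathcal A_{s(\gamma)}$. The transformation groupoid $\widehat{\mathcal A}\rtimes\mathcal R$ is the closed subspace $\{(\chi,u,\dot\gamma)\in\widehat{\mathcal A}\times\mathcal R: u=r(\gamma)\}$ with $(\chi,u,\dot\gamma)(\chi\cdot\gamma,s(\gamma),\dot\alpha)=(\chi,u,\dot\gamma\dot\alpha)$ and $(\chi,u,\dot\gamma)^{-1}=(\chi\cdot\gamma,s(\gamma),\dot\gamma^{-1})$; its unit space is identified with $\widehat{\mathcal A}$. Dynamic asymptotic dimension of a locally compact Hausdorff étale groupoid $H$: the smallest $d\in\mathbf N$ such that for every open precompact (i.e. having compact closure) $V\subset H$ there are open sets $U_0,\dots,U_d\subset H^{(0)}$ covering $s(V)\cup r(V)$ such that for each $i$ the set $\{\gamma\in V: s(\gamma),r(\gamma)\in U_i\}$ is contained in a precompact subgroupoid of $H$; it is $\infty$ if no such $d$ exists. *)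

(* Defs.v *)
From HB Require Import structures.
From mathcomp Require Import all_boot all_order all_algebra.
From mathcomp Require Import all_classical all_reals all_analysis.
From mathcomp Require Import complex.

Set Implicit Arguments.
Unset Strict Implicit.
Unset Printing Implicit Defensive.

Import Order.TTheory GRing.Theory Num.Theory.
Import numFieldNormedType.Exports.

Local Open Scope classical_set_scope.
Local Open Scope ring_scope.

(* Bare operations, without axioms.  [gmul] is total, but [gmul g h] is meaningful only
   when [(g, h)] is composable; [groupoid_laws] constrains it nowhere else. *)
Record groupoid := Groupoid {
  gcarrier :> topologicalType;
  gcomp : set (gcarrier * gcarrier);
  gmul : gcarrier -> gcarrier -> gcarrier;
  ginv : gcarrier -> gcarrier
}.

Definition grng (G : groupoid) (g : G) : G := gmul g (ginv g).
Definition gsrc (G : groupoid) (g : G) : G := gmul (ginv g) g.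
Definition gunits (G : groupoid) : set G := range (@grng G).
Arguments gunits : clear implicits.

Record groupoid_laws (G : groupoid) : Prop := {
  ginvK : forall g : G, ginv (ginv g) = g;
  gmulA : forall g h k : G, gcomp (g, h) -> gcomp (h, k) ->
    [/\ gcomp (gmul g h, k), gcomp (g, gmul h k) &
        gmul (gmul g h) k = gmul g (gmul h k)];
  gcompV : forall g : G, gcomp (ginv g, g);
  gmulK : forall g h : G, gcomp (g, h) ->
    gmul (ginv g) (gmul g h) = h /\ gmul (gmul g h) (ginv h) = g
}.

Record topological_groupoid (G : groupoid) : Prop := {
  tg_laws : groupoid_laws G;
  tg_inv : continuous (@ginv G);
  tg_mul : {within @gcomp G, continuous (fun p : G * G => gmul p.1 p.2)}
}.

(* [U] is an open subset of the unit space for its subspace topology. *)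
Definition open_in_units (G : groupoid) (U : set G) :=
  exists2 O : set G, open O & U = O `&` gunits G.

(* Local homeomorphism onto the unit space: [k] is the inverse of the restriction of the range map to [U]. *)
Definition range_local_homeo (G : groupoid) :=
  forall g : G, exists U : set G,
    [/\ open U, U g, open_in_units (@grng G @` U),
        {within U, continuous (@grng G)} &
        exists k : G -> G, {within @grng G @` U, continuous k} /\
          forall h, U h -> k (grng h) = h].

Definition etale (G : groupoid) := topological_groupoid G /\ range_local_homeo G.

Definition subgroupoid (G : groupoid) (K : set G) :=
  (forall g h, K g -> K h -> gcomp (g, h) -> K (gmul g h)) /\
  (forall g, K g -> K (ginv g)).

Definition dad_bound (G : groupoid) (d : nat) :=
  forall V : set G, open V -> precompact V ->
    exists U : 'I_d.+1 -> set G,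
      [/\ forall i, open_in_units (U i),
          (@gsrc G @` V) `|` (@grng G @` V) `<=` \bigcup_i U i &
          forall i, exists K : set G,
            [/\ subgroupoid K, precompact K &
                [set g | [/\ V g, U i (gsrc g) & U i (grng g)]] `<=` K]].

Definition dad_boundb (G : groupoid) (d : nat) : bool := `[< dad_bound G d >].

(* [None] stands for infinity. *)
Definition dad (G : groupoid) : option nat :=
  if pselect (exists d, dad_boundb G d) is left e then Some (ex_minn e) else None.

Definition dad_le (G : groupoid) (d : nat) : Prop :=
  if dad G is Some n then (n <= d)%N else False.

Definition stab (G : groupoid) (u : G) : set G :=
  [set a | grng a = u /\ gsrc a = u].

Definition abelian_stab (G : groupoid) :=
  forall u : G, gunits G u ->
    forall a b, stab u a -> stab u b -> gmul a b = gmul b a.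

(* The Fell topology, defined on all subsets of [T]; its restriction to the
   closed subsets (in particular to the closed subgroups of a Hausdorff
   groupoid) is the usual Fell topology. *)
Definition fell (T : Type) : Type := set T.

Section Fell.
Variable T : topologicalType.
Definition fell_miss (K : set T) : set (fell T) := [set F | F `&` K = set0].
Definition fell_hit (O : set T) : set (fell T) := [set F | F `&` O !=set0].
Definition fell_subbase : set (set (fell T)) :=
  (fell_miss @` compact) `|` (fell_hit @` open).
HB.instance Definition _ := Choice.copy (fell T) (set T).
HB.instance Definition _ := isSubBaseTopological.Build (fell T) fell_subbase id.
End Fell.

Definition continuous_stab (G : groupoid) :=
  {within gunits G, continuous (@stab G : G -> fell G)}.

Definition isotropy_set (G : groupoid) : set G := [set a | grng a = gsrc a].
Arguments isotropy_set : clear implicits.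

(* [insubd x y] is [y] seen as an element of the subtype of [x] when [y] belongs
   to it, which is the case for composable arguments, and [x] otherwise. *)
Definition isotropy (G : groupoid) : groupoid := {|
  gcarrier := set_type (isotropy_set G);
  gcomp := [set p | gcomp (val p.1, val p.2)];
  gmul := fun a b => insubd a (gmul (val a) (val b));
  ginv := fun a => insubd a (ginv (val a)) |}.

Definition iso_orbit (G : groupoid) (g : G) : set G :=
  [set gmul g a | a in [set a | isotropy_set G a /\ gcomp (g, a)]].

Definition same_orbit (G : groupoid) (g h : G) : bool :=
  `[< iso_orbit g = iso_orbit h >].

Lemma same_orbit_equiv (G : groupoid) : equiv_class_of (@same_orbit G).
Proof.
split=> [g|g h|h g k]; first exact/asboolP.
- by apply/asboolP/asboolP => ->.
- by move=> /asboolP gh /asboolP hk; apply/asboolP; rewrite gh.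
Qed.

Canonical same_orbit_equiv_rel (G : groupoid) :=
  EquivRelPack (same_orbit_equiv G).

Definition orbit_space (G : groupoid) : topologicalType :=
  quotient_topology {eq_quot same_orbit_equiv_rel G}%qT.

Definition orbit_class (G : groupoid) (g : G) : orbit_space G :=
  (\pi_(quotient_topology {eq_quot same_orbit_equiv_rel G}) g)%qT.
Definition orbit_repr (G : groupoid) (x : orbit_space G) : G :=
  repr (x : quotient_topology {eq_quot same_orbit_equiv_rel G}%qT).

Definition orbit_groupoid (G : groupoid) : groupoid := {|
  gcarrier := orbit_space G;
  gcomp := [set p | gcomp (orbit_repr p.1, orbit_repr p.2)];
  gmul := fun x y => orbit_class (gmul (orbit_repr x) (orbit_repr y));
  ginv := fun x => orbit_class (ginv (orbit_repr x)) |}.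

Definition Cplx (R : realType) : numClosedFieldType := R[i].

Definition cabs (R : realType) (z : Cplx R) : R := complex.Re `|z|.

Definition cint (R : realType) d (T : measurableType d)
    (mu : {measure set T -> \bar R}) (D : set T) (f : T -> Cplx R) : Cplx R :=
  Complex (\int[mu]_(x in D) complex.Re (f x))
          (\int[mu]_(x in D) complex.Im (f x)).

Definition Cc (R : realType) (X : topologicalType) (f : X -> Cplx R) :=
  continuous f /\ compact (closure [set x | f x != 0]).

(* The Borel sigma-algebra.  The library requires measurable types to be
   pointed; as a groupoid may be empty, the base point is provided by the
   unit at which the measure is considered. *)
Definition pointed_at (X : topologicalType) (u : X) : Type := X.
HB.instance Definition _ (X : topologicalType) (u : X) :=
  Topological.copy (pointed_at u) X.
HB.instance Definition _ (X : topologicalType) (u : X) :=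
  isPointed.Build (pointed_at u) u.

Definition borel (X : topologicalType) (u : X) :=
  g_sigma_algebraType (@open (pointed_at u)).

Definition gfiber (G : groupoid) (u : G) : set G := [set g | grng g = u].

(* The groupoids under consideration are second countable, locally compact and
   Hausdorff, so that Borel measures that are finite on compact sets are Radon.
   Only the measures [haar u] for [u] a unit are relevant. *)
Record haar_system (R : realType) (G : groupoid) := HaarSystem {
  haar :> forall u : G, {measure set (borel u) -> \bar R};
  haar_compact : forall u, gunits G u ->
    forall K : set G, compact K -> (haar u K < +oo)%E;
  haar_supp : forall u, gunits G u -> haar u (~` gfiber u) = 0%E /\
    forall O : set G, open O -> O `&` gfiber u !=set0 -> (0 < haar u O)%E;
  haar_continuous : forall f : G -> Cplx R, Cc f ->
    {within gunits G, continuous (fun u => cint (haar u) (gfiber u) f)};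
  haar_invariant : forall (g : G) (f : G -> Cplx R), Cc f ->
    cint (haar (gsrc g)) (gfiber (gsrc g)) (fun h => f (gmul g h)) =
    cint (haar (grng g)) (gfiber (grng g)) f
}.

Section CStar.
Variables (R : realType) (G : groupoid) (nu : haar_system R G).
Implicit Types f g : G -> Cplx R.

Definition conv f g : G -> Cplx R := fun x =>
  cint (nu (grng x)) (gfiber (grng x)) (fun y => f y * g (gmul (ginv y) x)).

Definition gstar f : G -> Cplx R := fun x => (f (ginv x))^*.

Definition Inorm f : \bar R := maxe
  (ereal_sup [set (\int[nu u]_(x in gfiber u) (cabs (f x))%:E)%E
             | u in gunits G])
  (ereal_sup [set (\int[nu u]_(x in gfiber u) (cabs (f (ginv x)))%:E)%E
             | u in gunits G]).

(* C*-seminorms on the *-algebra C_c(G, nu) that are dominated by the I-norm,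
   i.e. the seminorms f |-> ||pi f|| of its I-norm bounded *-representations. *)
Record cstar_seminorm (p : (G -> Cplx R) -> R) : Prop := {
  csn_ge0 : forall f, Cc f -> 0 <= p f;
  csnD : forall f g, Cc f -> Cc g -> p (f \+ g) <= p f + p g;
  csnZ : forall (c : Cplx R) f, Cc f -> p (fun x => c * f x) = cabs c * p f;
  csnM : forall f g, Cc f -> Cc g -> p (conv f g) <= p f * p g;
  csn_star : forall f, Cc f -> p (conv (gstar f) f) = p f ^+ 2;
  csn_I : forall f, Cc f -> ((p f)%:E <= Inorm f)%E
}.

Definition cstar_norm f : \bar R :=
  ereal_sup [set (p f)%:E | p in cstar_seminorm].

(* The elements of the completion C*(G, nu) of C_c(G, nu), each represented by
   the Cauchy sequences that converge to it. *)
Record cstar := CStarElt {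
  cstar_seq :> nat -> G -> Cplx R;
  cstar_Cc : forall n, Cc (cstar_seq n);
  cstar_cauchy : forall e : R, 0 < e -> exists N, forall m n,
    (N <= m)%N -> (N <= n)%N ->
    (cstar_norm (cstar_seq m \- cstar_seq n)%R < e%:E)%E
}.

End CStar.

(* [chi] is a character of the stability subgroup at [u], extended by 0 to G. *)
Record stab_character (R : realType) (G : groupoid) (chi : G -> Cplx R) (u : G)
  : Prop := {
  char_unit : gunits G u;
  char_out : forall a, ~ stab u a -> chi a = 0;
  char_norm : forall a, stab u a -> `|chi a| = 1;
  charM : forall a b, stab u a -> stab u b -> chi (gmul a b) = chi a * chi b;
  char_continuous : {within stab u, continuous chi}
}.

Section Dual.
Variables (R : realType) (G : groupoid).

Definition dual_set : set ((G -> Cplx R) * isotropy G) :=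
  [set p | stab_character p.1 (val p.2)].
Definition dual_point : choiceType := set_type dual_set.

Definition dual_char (x : dual_point) : G -> Cplx R := (val x).1.
Definition dual_unit (x : dual_point) : isotropy G := (val x).2.
Definition dual_anchor (x : dual_point) : G := val (dual_unit x).

(* [(chi, u)] acts on C_c(A, nu) by integration over the stability subgroup at
   [u], which is the range fiber over [u] of the isotropy groupoid, ... *)
Definition dual_pairing (nu : haar_system R (isotropy G)) (x : dual_point)
    (f : isotropy G -> Cplx R) : Cplx R :=
  cint (nu (dual_unit x)) (gfiber (dual_unit x))
       (fun a => dual_char x (val a) * f a).

(* ... and on the completion C*(A, nu) by continuity. *)
Definition dual_eval (nu : haar_system R (isotropy G)) (x : dual_point) :
    {ptws (cstar nu) -> (Cplx R)} :=
  fun F => lim ((fun n => dual_pairing nu x (F n)) @ \oo).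
Arguments dual_eval : clear implicits.

(* The weak-* topology: pointwise convergence on C*(A, nu). *)
Definition dual (nu : haar_system R (isotropy G)) : topologicalType :=
  initial_topology (dual_eval nu).

(* When the range of [g] is the anchor of [x], the arguments of both
   occurrences of [insubd] belong to the relevant subtypes. *)
Definition dual_act (x : dual_point) (g : G) : dual_point :=
  insubd x
    ((fun a => if `[< stab (gsrc g) a >]
               then dual_char x (gmul (gmul g a) (ginv g)) else 0),
     insubd (dual_unit x) (gsrc g)).

End Dual.

Section Transformation.
Variables (R : realType) (G : groupoid) (nu : haar_system R (isotropy G)).

Definition trans_set : set (dual nu * orbit_groupoid G) :=
  [set z | dual_anchor z.1 = grng (orbit_repr z.2)].

(* The action of the class of [g] is that of [g]; it does not depend on the
   choice of [g] as the stability subgroups are abelian. *)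
Definition trans_act (z : dual nu * orbit_groupoid G) : dual nu :=
  dual_act z.1 (orbit_repr z.2).

Definition trans_groupoid : groupoid := {|
  gcarrier := set_type trans_set;
  gcomp := [set p | (val p.2).1 = trans_act (val p.1)];
  gmul := fun z w => insubd z ((val z).1, gmul (val z).2 (val w).2);
  ginv := fun z => insubd z (trans_act (val z), ginv (val z).2) |}.

End Transformation.

(* Main.v *)
(* As [G] is etale its stability groups are discrete, so the Haar measure on the
   isotropy group at [u] is [c u] times the counting measure, with [c] positive and
   continuous.  Each character then gives a functional on [C_c(A)] whose modulus is a
   C*-seminorm, hence is bounded by the norm of [C*(A, nu)]; so the weak-* topology of
   the dual is already determined by [C_c(A)].  There the action of a local section [k]
   of the range map is dual, up to the factor [c], to the conjugation of functions by
   [k], which proves that the action is continuous.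

   A class in the orbit groupoid is determined by its range and its source, and the
   continuity of the stability groups makes the quotient map open; therefore local
   sections of the range map of [G] induce local sections of the range maps of the
   orbit groupoid and of the transformation groupoid.

   For the dynamic asymptotic dimension, covers are pulled back along the projection
   to the orbit groupoid. *)

Require Import Defs.
From mathcomp Require Import all_boot all_order all_algebra.
From mathcomp Require Import all_classical all_reals all_analysis.
From mathcomp Require Import complex ring.

Set Implicit Arguments.
Unset Strict Implicit.
Unset Printing Implicit Defensive.

Import Order.TTheory GRing.Theory Num.Theory.
Import numFieldNormedType.Exports.

Local Open Scope classical_set_scope.
Local Open Scope ring_scope.

(** * Groupoid algebra *)

(** Two obstacles shape the proof. The operations on classes go through the chosen representative
    [orbit_repr], which has no continuity. Continuity is therefore always checked after replacing
    it, near a given class, by a section with values in [G]. For products this replacement is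
    harmless because a class is determined by its range and source; for the action on characters it
    is justified by the commutativity of the stability groups.

    Secondly, a section [k] conjugates isotropy elements only over an open set of units, so a
    function in [Cc] composed with this conjugation is not yet a function on the whole isotropy
    groupoid. It is multiplied by a bump function equal to 1 at the unit under study. The bump, like
    the Haar weights at the two ends of [k u], is divided out again in the final formula, which is
    why the continuity and positivity of the weights have to be known beforehand. *)

Section GroupoidLaws.
Variable G : groupoid.
Hypothesis GL : groupoid_laws G.
Implicit Types g h k u a b : G.

Lemma gcompgV g : gcomp (g, ginv g).
Proof. by have := gcompV GL (ginv g); rewrite ginvK. Qed.

Lemma grng_mull g : gmul (grng g) g = g.
Proof. by have [_] := gmulK GL (gcompgV g); rewrite (ginvK GL). Qed.

Lemma gsrc_mulr g : gmul g (gsrc g) = g.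
Proof. by have [+ _] := gmulK GL (gcompV GL g); rewrite (ginvK GL). Qed.

Lemma grngV g : grng (ginv g) = gsrc g.
Proof. by rewrite /grng (ginvK GL). Qed.

Lemma gsrcV g : gsrc (ginv g) = grng g.
Proof. by rewrite /gsrc (ginvK GL). Qed.

(** The laws give [gcomp] as a bare relation. The two bracketings of g^-1 (g h) h^-1 yield h h^-1 =
    g^-1 g; conversely [g] composes with its source, which, being the range of [h], composes with
    [h]. *)
Lemma gcompP g h : gcomp (g, h) <-> gsrc g = grng h.
Proof.
split=> [gh|E].
  have [E1 E2] := gmulK GL gh.
  have [_ c1 _] := gmulA GL (gcompV GL g) gh.
  have [c2 _ _] := gmulA GL gh (gcompgV h).
  by have [_ _] := gmulA GL c1 c2; rewrite E1 E2.
have [_ c1 _] := gmulA GL (gcompgV g) (gcompV GL g).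
have [c2 _ _] := gmulA GL (gcompgV h) (gcompV GL h).
rewrite -/(gsrc g) E in c1; rewrite -/(grng h) in c2.
by have [_ + _] := gmulA GL c1 c2; rewrite grng_mull.
Qed.

Lemma grng_mul g h : gsrc g = grng h -> grng (gmul g h) = grng g.
Proof.
move=> /gcompP gh.
have [_ /gcompP c1 _] := gmulA GL (gcompV GL g) gh.
by rewrite -c1 gsrcV.
Qed.

Lemma gsrc_mul g h : gsrc g = grng h -> gsrc (gmul g h) = gsrc h.
Proof.
move=> /gcompP gh.
have [/gcompP -> _ _] := gmulA GL gh (gcompgV h).
exact: grngV.
Qed.

Lemma gmulAe g h k : gsrc g = grng h -> gsrc h = grng k ->
  gmul (gmul g h) k = gmul g (gmul h k).
Proof. by move=> /gcompP gh /gcompP hk; have [] := gmulA GL gh hk. Qed.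

Lemma grng_rng g : grng (grng g) = grng g.
Proof. by rewrite {2}/grng grng_mul// grngV. Qed.

Lemma gsrc_rng g : gsrc (grng g) = grng g.
Proof. by rewrite {2}/grng gsrc_mul ?gsrcV// grngV. Qed.

Lemma grng_src g : grng (gsrc g) = gsrc g.
Proof. by rewrite -grngV grng_rng. Qed.

Lemma gsrc_src g : gsrc (gsrc g) = gsrc g.
Proof. by rewrite -(grngV g) gsrc_rng. Qed.

Lemma gunitsP u : gunits G u <-> grng u = u.
Proof. by split=> [[g _ <-]|<-]; [exact: grng_rng|exists u]. Qed.

Lemma gunits_rng g : gunits G (grng g).
Proof. by exists g. Qed.

Lemma gunits_src g : gunits G (gsrc g).
Proof. by rewrite -grngV; exists (ginv g). Qed.

Lemma gsrc_unit u : gunits G u -> gsrc u = u.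
Proof. by move=> /gunitsP E; rewrite -E gsrc_rng. Qed.

Lemma grng_unit u : gunits G u -> grng u = u.
Proof. by move=> /gunitsP. Qed.

Lemma gmulVKe g h : gsrc g = grng h -> gmul (ginv g) (gmul g h) = h.
Proof. by move=> /gcompP /(gmulK GL)[]. Qed.

Lemma gmulKVe g h : grng g = grng h -> gmul g (gmul (ginv g) h) = h.
Proof. by rewrite -gsrcV => /gmulVKe; rewrite (ginvK GL). Qed.

Lemma gmulKe g h : gsrc g = grng h -> gmul (gmul g h) (ginv h) = g.
Proof. by move=> /gcompP /(gmulK GL)[]. Qed.

Lemma gmulVe g h : gsrc g = gsrc h -> gmul (gmul g (ginv h)) h = g.
Proof. by rewrite -(grngV h) => /gmulKe; rewrite (ginvK GL). Qed.

Lemma gmul_injl g h k : gsrc g = grng h -> gsrc g = grng k ->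
  gmul g h = gmul g k -> h = k.
Proof. by move=> gh gk E; rewrite -(gmulVKe gh) E gmulVKe. Qed.

Lemma ginv_mul g h : gsrc g = grng h ->
  ginv (gmul g h) = gmul (ginv h) (ginv g).
Proof.
move=> gh; apply: (@gmul_injl (gmul g h)); rewrite ?grngV//.
  by rewrite grng_mul ?grngV ?gsrcV ?gsrc_mul.
rewrite -/(grng _) grng_mul// gmulAe//; last first.
  by rewrite grng_mul ?grngV// gsrcV.
by rewrite gmulKVe// grngV.
Qed.

Lemma ginv_unit u : gunits G u -> ginv u = u.
Proof.
move=> uu; have := grng_mull (ginv u).
rewrite grngV (gsrc_unit uu); have /gunitsP := uu; rewrite /grng => E.
by rewrite E.
Qed.

Definition gconj g a := gmul (gmul (ginv g) a) g.

Lemma stab_conj g a : stab (grng g) a -> stab (gsrc g) (gconj g a).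
Proof.
move=> [ra sa]; rewrite /gconj; split.
  by rewrite grng_mul ?grng_mul ?gsrc_mul ?grngV ?gsrcV.
by rewrite gsrc_mul ?gsrc_mul ?gsrcV ?grngV.
Qed.

Lemma gconjK g a : stab (gsrc g) a -> gconj g (gconj (ginv g) a) = a.
Proof.
move=> [ra sa]; rewrite /gconj (ginvK GL).
rewrite [gmul (gmul g a) _]gmulAe ?grngV//.
by rewrite gmulVKe ?gmulVe// grng_mul ?grngV.
Qed.

Lemma gconjVK g a : stab (grng g) a -> gconj (ginv g) (gconj g a) = a.
Proof. by rewrite -gsrcV => /gconjK; rewrite (ginvK GL). Qed.

Lemma gconjM g a b : stab (grng g) a -> stab (grng g) b ->
  gconj g (gmul a b) = gmul (gconj g a) (gconj g b).
Proof.
move=> [ra sa] [rb sb]; rewrite /gconj.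
have rg : gsrc (ginv g) = grng g by exact: gsrcV.
rewrite [RHS]gmulAe ?gsrc_mul ?grng_mul ?gsrcV ?grngV ?gsrc_mul ?gsrcV//.
rewrite -[gmul g (gmul _ g)]gmulAe ?gsrc_mul ?grng_mul ?gsrcV ?grngV//.
rewrite gmulKVe//.
by rewrite -!gmulAe ?gsrc_mul ?grng_mul ?gsrcV ?grngV ?sa ?rb ?rg//.
Qed.

Lemma gconj_comp g h a : gsrc g = grng h -> stab (grng g) a ->
  gconj (gmul g h) a = gconj h (gconj g a).
Proof.
move=> gh [ra sa]; rewrite /gconj ginv_mul//.
by rewrite !gmulAe ?gsrc_mul ?grng_mul ?gsrcV ?grngV ?sa ?ra ?gsrc_mul ?gsrcV//
  ?grng_mul ?gsrcV ?grngV ?sa ?ra ?grng_mul ?gsrcV ?grngV.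
Qed.

Lemma stabM u a b : stab u a -> stab u b -> stab u (gmul a b).
Proof.
move=> [ra sa] [rb sb].
by split; rewrite ?grng_mul ?gsrc_mul ?sa ?rb.
Qed.

Lemma stabV u a : stab u a -> stab u (ginv a).
Proof. by move=> [ra sa]; split; rewrite ?grngV ?gsrcV. Qed.

(** The element b = h g^-1 lies in the stability group at the common range, where conjugation by it
    is trivial. Commutativity enters here: it makes the action of a class independent of the
    representative. *)
Lemma gconj_abelian g h a : abelian_stab G -> grng g = grng h -> gsrc g = gsrc h ->
  stab (grng g) a -> gconj g a = gconj h a.
Proof.
move=> ab rgh sgh sa; set b := gmul h (ginv g).
have rb : stab (grng g) b.
  by split; rewrite /b ?grng_mul ?gsrc_mul ?grngV ?gsrcV -?rgh.
have hE : h = gmul b g by rewrite /b gmulVe.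
have sbg : gsrc b = grng g by case: rb.
rewrite [in RHS]hE gconj_comp// ?rb.1//.
congr gconj; rewrite /gconj.
have -> : gmul (ginv b) a = gmul a (ginv b).
  by apply: (ab (grng g)) => //; [exact: gunits_rng|exact: stabV].
by rewrite gmulVe// sbg sa.2.
Qed.

End GroupoidLaws.

(** * Topological groupoids *)

(** Multiplication is continuous only within [gcomp], so composability is required eventually along
    the filter and at the limit. The filter is arbitrary because later limits are taken along other
    spaces. *)
Lemma cvg_gmul (G : groupoid) (GT : topological_groupoid G) (Z : Type)
    (F : set_system Z) (FF : Filter F) (a b : Z -> G) (a0 b0 : G) :
  a @ F --> a0 -> b @ F --> b0 -> (\forall z \near F, gcomp (a z, b z)) ->
  gcomp (a0, b0) -> gmul (a z) (b z) @[z --> F] --> gmul a0 b0.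
Proof.
move=> ca cb cab c0.
have /subspace_continuousP/(_ (a0, b0) c0) cm := tg_mul GT.
apply: (cvg_comp (fun z => (a z, b z)) (fun p => gmul p.1 p.2) _ cm).
move=> U; rewrite /= /nbhs/= /within/= => -[[P Q]/= [Pa Qb] PQ].
near=> z; apply: (PQ (a z, b z)); last by near: z.
by split; near: z; [exact: ca|exact: cb].
Unshelve. all: by end_near.
Qed.

Section TopologicalGroupoid.
Variable G : groupoid.
Hypothesis GT : topological_groupoid G.
Let GL := tg_laws GT.

Lemma grng_continuous : continuous (@grng G).
Proof.
move=> g; apply: cvg_gmul => //; [exact: tg_inv| |exact: gcompgV].
by near=> h; exact: gcompgV.
Unshelve. all: by end_near.
Qed.

Lemma gsrc_continuous : continuous (@gsrc G).
Proof.
move=> g; apply: cvg_gmul => //; [exact: tg_inv| |exact: gcompV].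
by near=> h; exact: gcompV.
Unshelve. all: by end_near.
Qed.

Lemma gconj_cvg (Z : Type) (F : set_system Z) (FF : Filter F) (g a : Z -> G) (g0 a0 : G) :
  g @ F --> g0 -> a @ F --> a0 ->
  (\forall z \near F, stab (grng (g z)) (a z)) -> stab (grng g0) a0 ->
  gconj (g z) (a z) @[z --> F] --> gconj g0 a0.
Proof.
move=> cg ca sga s0; rewrite /gconj; apply: cvg_gmul => //.
- apply: cvg_gmul => //.
  + by apply: (cvg_comp g (@ginv G) cg); exact: tg_inv.
  + near=> z; apply/(gcompP GL); rewrite gsrcV//.
    by have [-> _] : stab (grng (g z)) (a z) by near: z.
  + by apply/(gcompP GL); rewrite gsrcV// s0.1.
- near=> z; apply/(gcompP GL).
  have [ra sa] : stab (grng (g z)) (a z) by near: z.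
  by rewrite gsrc_mul// gsrcV.
- by apply/(gcompP GL); rewrite gsrc_mul ?s0.2// gsrcV// s0.1.
Unshelve. all: by end_near.
Qed.

End TopologicalGroupoid.

(** For [v] near a unit, [v] and [grng v] both lie in a neighbourhood on which the range is
    injective, and they have the same range. Assuming only local injectivity lets the lemma serve
    the isotropy groupoid too. *)
Lemma open_gunits_of (G : groupoid) : groupoid_laws G -> continuous (@grng G) ->
  (forall g : G, exists U : set G,
    [/\ open U, U g & forall h k, U h -> U k -> grng h = grng k -> h = k]) ->
  open (gunits G).
Proof.
move=> GL rC inj; rewrite openE => u uu; rewrite /interior.
have [U [oU Uu Uinj]] := inj u.
have nU : nbhs u U by exact: open_nbhs_nbhs.
have nV : nbhs u (@grng G @^-1` U).
  by apply: rC; rewrite (grng_unit GL uu); exact: nU.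
near=> v; apply/(gunitsP GL); apply: Uinj.
- by near: v.
- by near: v.
- exact: grng_rng.
Unshelve. all: by end_near.
Qed.

Section EtaleGroupoid.
Variable G : groupoid.
Hypothesis GE : etale G.
Let GT : topological_groupoid G := GE.1.
Let GL := tg_laws GT.

Lemma range_inj_nbhs (g : G) : exists U : set G,
  [/\ open U, U g & forall h k, U h -> U k -> grng h = grng k -> h = k].
Proof.
have [U [oU Ug _ _ [k [_ kK]]]] := GE.2 g.
by exists U; split=> // h h' /kK {2}<- /kK {2}<- ->.
Qed.

Lemma open_gunits : open (gunits G).
Proof.
apply: open_gunits_of => //; [exact: grng_continuous|exact: range_inj_nbhs].
Qed.

(** As the unit space is open, the local inverse of the range has an open domain in [G] and is
    continuous at its points in the full sense, not merely within a subspace. *)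
Lemma range_section (g : G) : exists (U D : set G) (k : G -> G),
  [/\ open U /\ U g, open D /\ D `<=` gunits G,
      forall h, U h -> D (grng h) /\ k (grng h) = h,
      forall u, D u -> U (k u) /\ grng (k u) = u &
      forall u, D u -> {for u, continuous k}].
Proof.
have [U [oU Ug [P oP PE] _ [k [ck kK]]]] := GE.2 g.
have oD : open (grng (G := G) @` U).
  by rewrite PE; apply: openI => //; exact: open_gunits.
exists U, (grng (G:=G) @` U), k; split => //.
- by split => //; rewrite PE => u [].
- by move=> h Uh; split; [exists h|exact: kK].
- by move=> _ [h Uh <-]; rewrite kK.
- by move=> u Du; move: ck; rewrite continuous_open_subspace// => /(_ u); apply; rewrite inE.
Qed.

End EtaleGroupoid.

(** * The orbit groupoid *)

Section OrbitGroupoid.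
Variable G : groupoid.
Hypothesis GE : etale G.
Let GT : topological_groupoid G := GE.1.
Let GL := tg_laws GT.

Lemma same_orbitP (g h : G) :
  same_orbit g h <-> grng g = grng h /\ gsrc g = gsrc h.
Proof.
have sub (g' h' : G) : grng g' = grng h' -> gsrc g' = gsrc h' -> iso_orbit g' `<=` iso_orbit h'.
  move=> r s _ [a [ia /(gcompP GL) ga] <-].
  have hg : gsrc (ginv h') = grng g' by rewrite gsrcV.
  have hga : gsrc (gmul (ginv h') g') = grng a by rewrite gsrc_mul.
  exists (gmul (gmul (ginv h') g') a); last first.
    by rewrite gmulAe// gmulKVe// -r grng_mul.
  split; last by apply/(gcompP GL); rewrite grng_mul// grng_mul// grngV.
  by rewrite /isotropy_set/= grng_mul// grng_mul// gsrc_mul// grngV// -s ga -ia.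
split.
  move=> /asboolP E.
  have : iso_orbit h g.
    rewrite -E; exists (gsrc g); last exact: gsrc_mulr.
    split; first by rewrite /isotropy_set/= grng_src// gsrc_src.
    by apply/(gcompP GL); rewrite grng_src.
  move=> [a [ia /(gcompP GL) ha] <-].
  by rewrite grng_mul// gsrc_mul// ha ia.
move=> [r s]; apply/asboolP; apply/seteqP; split; exact: sub.
Qed.

Lemma orbit_reprK (x : orbit_space G) : orbit_class (orbit_repr x) = x.
Proof. exact: reprK. Qed.

Lemma orbit_classP (g h : G) :
  orbit_class g = orbit_class h <-> grng g = grng h /\ gsrc g = gsrc h.
Proof.
rewrite -same_orbitP; split; last by move=> gh; apply/eqmodP.
by move=> E; apply/(@eqmodP _ (same_orbit_equiv_rel G)).
Qed.

Lemma orbit_repr_class (g : G) :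
  grng (orbit_repr (orbit_class g)) = grng g /\
  gsrc (orbit_repr (orbit_class g)) = gsrc g.
Proof. by apply/orbit_classP; rewrite orbit_reprK. Qed.

End OrbitGroupoid.

Lemma open_fell_hit (T : topologicalType) (P : set T) :
  open P -> open (fell_hit P : set (fell T)).
Proof.
move=> oP; exists [set fell_hit P]; last by rewrite bigcup_set1.
move=> _ ->; apply: (finI_from1 (i := fell_hit P) id).
by right; exists P.
Qed.

(** * Topology of the orbit groupoid *)

Section OrbitTopology.
Variable G : groupoid.
Hypothesis GE : etale G.
Hypothesis GS : continuous_stab G.
Let GT : topological_groupoid G := GE.1.
Let GL := tg_laws GT.

(** The subbasic Fell-open set [fell_hit P] contains the stability group at [gsrc a], hence those at
    nearby units: isotropy elements can be followed to nearby units. *)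
Lemma stab_lower_semicontinuous (P : set G) (a : G) :
  open P -> P a -> isotropy_set G a ->
  \forall u \near gsrc a, gunits G u -> stab u `&` P !=set0.
Proof.
move=> oP Pa ia.
have /subspace_continuousP/(_ (gsrc a) (gunits_src GL a)) := GS.
move=> /(_ (fell_hit P)); apply.
apply: open_nbhs_nbhs; split; first exact: open_fell_hit.
by exists a; split => //; split.
Qed.

(** If [h] has the class of some [g] in [P], then h = g a with [a] in the isotropy. For h' near [h],
    the previous lemma gives an isotropy element [b] near [a] at the source of h'; then h' b^-1 is
    near h a^-1 = g, hence in [P], and has the class of h'. *)
Lemma orbit_class_open (P : set G) : open P -> open (@orbit_class G @` P).
Proof.
move=> oP; rewrite /open/= /quotient_open openE => h [g Pg /(orbit_classP GE)[rgh sgh]].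
rewrite /interior.
pose a := gmul (ginv g) h.
have ra : grng a = gsrc g by rewrite /a grng_mul// ?grngV// gsrcV.
have sa : gsrc a = gsrc h by rewrite /a gsrc_mul// gsrcV.
have ia : isotropy_set G a by rewrite /isotropy_set/= ra sa.
have : \forall p \near (h, a), gcomp (p.1, ginv p.2) -> P (gmul p.1 (ginv p.2)).
  have gE : g = gmul h (ginv a).
    rewrite /a ginv_mul ?gsrcV// (ginvK GL) gmulKVe//.
  have /subspace_continuousP/(_ (h, ginv a)) := tg_mul GT.
  have -> : from_subspace (gcomp (g := G)) (fun p : G * G => gmul p.1 p.2)
    (h, ginv a) = g by rewrite gE.
  have cha : gcomp (h, ginv a) by apply/(gcompP GL); rewrite grngV// sa.
  move=> /(_ cha P (open_nbhs_nbhs (conj oP Pg))).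
  move=> [[/= P1 P2] [/= n1 n2] PP].
  exists (P1, @ginv G @^-1` P2).
    by split => //=; apply: (tg_inv GT).
  by move=> [h' a'] [/= p1 p2] c; exact: (PP (h', ginv a')).
move=> [[/= P1 P2] [/= n1 n2] PP].
have n3 := stab_lower_semicontinuous (@open_interior _ P2) n2 ia.
rewrite sa in n3.
near=> h'.
have [b [[rb sb] /interior_subset P2b]] : stab (gsrc h') `&` P2° !=set0.
  have := gunits_src GL h'; near: h'.
  exact: (gsrc_continuous GT n3).
have h'b : gsrc h' = grng (ginv b) by rewrite grngV.
exists (gmul h' (ginv b)).
  apply: (PP (h', b)); first by split => //=; near: h'.
  by apply/(gcompP GL).
by apply/(orbit_classP GE); rewrite grng_mul// gsrc_mul// gsrcV.
Unshelve. all: by end_near.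
Qed.

Definition orng (x : orbit_space G) : G := grng (orbit_repr x).
Definition osrc (x : orbit_space G) : G := gsrc (orbit_repr x).

Lemma orbit_class_continuous : continuous (@orbit_class G).
Proof. exact: pi_continuous. Qed.

Lemma orng_class (g : G) : orng (orbit_class g) = grng g.
Proof. exact: (orbit_repr_class GE g).1. Qed.

Lemma osrc_class (g : G) : osrc (orbit_class g) = gsrc g.
Proof. exact: (orbit_repr_class GE g).2. Qed.

Lemma orng_continuous : continuous orng.
Proof.
apply/quotient_continuous; rewrite [X in continuous X](_ : _ = @grng G).
  exact: grng_continuous.
by apply/funext => g /=; exact: orng_class.
Qed.

Lemma osrc_continuous : continuous osrc.
Proof.
apply/quotient_continuous; rewrite [X in continuous X](_ : _ = @gsrc G).
  exact: gsrc_continuous.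
by apply/funext => g /=; exact: osrc_class.
Qed.

Lemma orbit_eqP (x y : orbit_space G) : orng x = orng y -> osrc x = osrc y -> x = y.
Proof.
by move=> r s; rewrite -(orbit_reprK x) -(orbit_reprK y); apply/(orbit_classP GE).
Qed.

(** Range and source are continuous on the orbit space and jointly injective, so they separate its
    points. *)
Lemma orbit_hausdorff : hausdorff_space G -> hausdorff_space (orbit_space G).
Proof.
move=> GH x y xy; apply: orbit_eqP; apply: GH => A B nA nB.
- by have [z [zA zB]] := xy _ _ (orng_continuous nA) (orng_continuous nB); exists (orng z).
- by have [z [zA zB]] := xy _ _ (osrc_continuous nA) (osrc_continuous nB); exists (osrc z).
Qed.

(** This supplies representatives that vary continuously, as a replacement for [orbit_repr] near
    [x0]. *)
Lemma orbit_section (x0 : orbit_space G) :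
  exists (N : set (orbit_space G)) (D : set G) (k : G -> G),
  [/\ open N /\ N x0, open D /\ D `<=` gunits G,
      forall x, N x -> D (orng x) /\ orbit_class (k (orng x)) = x,
      forall u, D u -> grng (k u) = u /\ N (orbit_class (k u)) &
      forall u, D u -> {for u, continuous k}].
Proof.
have [U [D [k [[oU Ug] [oD Du] UD DU ck]]]] := range_section GE (orbit_repr x0).
exists (@orbit_class G @` U), D, k; split => //.
- split; first exact: orbit_class_open.
  by exists (orbit_repr x0) => //; exact: orbit_reprK.
- by move=> _ [h Uh <-]; rewrite orng_class; have [? ->] := UD _ Uh.
- by move=> u /DU[Uk kE]; split=> //; exists (k u).
Qed.

Let R := orbit_groupoid G.

Lemma orbit_ginv (g : G) : ginv (orbit_class g : R) = orbit_class (ginv g).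
Proof.
apply/(orbit_classP GE); have [r s] := orbit_repr_class GE g.
by rewrite !grngV// !gsrcV.
Qed.

Lemma orbit_gmul (g h : G) : gsrc g = grng h ->
  gmul (orbit_class g : R) (orbit_class h) = orbit_class (gmul g h).
Proof.
move=> gh; apply/(orbit_classP GE).
have [r s] := orbit_repr_class GE g; have [r' s'] := orbit_repr_class GE h.
by rewrite !grng_mul ?gsrc_mul ?s ?s' ?r'.
Qed.

Lemma orng_mul (x y : R) : osrc x = orng y -> orng (gmul x y) = orng x.
Proof. by move=> xy; rewrite orng_class grng_mul. Qed.

Lemma osrc_mul (x y : R) : osrc x = orng y -> osrc (gmul x y) = osrc y.
Proof. by move=> xy; rewrite osrc_class gsrc_mul. Qed.

Lemma orngV (x : R) : orng (ginv x) = osrc x.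
Proof. by rewrite orng_class grngV. Qed.

Lemma osrcV (x : R) : osrc (ginv x) = orng x.
Proof. by rewrite osrc_class gsrcV. Qed.

Lemma orbit_gmulA (x y z : R) : osrc x = orng y -> osrc y = orng z ->
  gmul (gmul x y) z = gmul x (gmul y z).
Proof.
by move=> xy yz; apply: orbit_eqP; rewrite ?orng_mul ?osrc_mul ?orng_mul.
Qed.

Lemma orbit_grng (x : R) : grng x = orbit_class (orng x).
Proof.
rewrite /grng; apply: orbit_eqP; rewrite ?orng_mul ?osrc_mul ?orngV//.
  by rewrite orng_class grng_rng.
by rewrite osrcV osrc_class gsrc_rng.
Qed.

Lemma orbit_gunitsP (x : R) : gunits R x <-> orbit_class (orng x) = x.
Proof.
split=> [[y _ <-]|E]; last by exists x; rewrite ?orbit_grng.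
by rewrite orbit_grng orng_class grng_rng.
Qed.

Lemma orbit_ginv_continuous : continuous (@ginv R).
Proof.
apply/quotient_continuous; rewrite [X in continuous X](_ : _ = @orbit_class G \o @ginv G).
  by move=> g; apply: continuous_comp; [exact: tg_inv|exact: orbit_class_continuous].
by apply/funext => g /=; exact: orbit_ginv.
Qed.

(** Near the limits both factors are lifted by local sections; the product converges in [G] and is
    then projected. *)
Lemma orbit_gmul_cvg (Z : Type) (F : set_system Z) (FF : Filter F)
    (a b : Z -> R) (a0 b0 : R) :
  a @ F --> a0 -> b @ F --> b0 -> (\forall z \near F, osrc (a z) = orng (b z)) ->
  osrc a0 = orng b0 -> gmul (a z) (b z) @[z --> F] --> gmul a0 b0.
Proof.
move=> ca cb cab c0.
have [N [D [k [[oN Na] _ ND DN ck]]]] := orbit_section a0.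
have [N' [D' [k' [[oN' Nb] _ ND' DN' ck']]]] := orbit_section b0.
have [Da ka] := ND _ Na; have [Db kb] := ND' _ Nb.
have comp0 : gsrc (k (orng a0)) = grng (k' (orng b0)).
  by rewrite -osrc_class ka -orng_class kb.
have E : gmul a0 b0 = orbit_class (gmul (k (orng a0)) (k' (orng b0))).
  by rewrite -orbit_gmul// ka kb.
rewrite E.
apply: (cvg_trans (G := orbit_class (gmul (k (orng (a z))) (k' (orng (b z)))) @[z --> F])).
  apply: near_eq_cvg; near=> z.
  have Naz : N (a z) by near: z; apply: ca; exact: open_nbhs_nbhs.
  have Nbz : N' (b z) by near: z; apply: cb; exact: open_nbhs_nbhs.
  have [Daz kaz] := ND _ Naz; have [Dbz kbz] := ND' _ Nbz.
  have cz : osrc (a z) = orng (b z) by near: z.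
  by rewrite -orbit_gmul ?kaz ?kbz// -osrc_class kaz -orng_class kbz.
apply: (cvg_comp (fun z => gmul (k (orng (a z))) (k' (orng (b z))))
  (@orbit_class G) _ (@orbit_class_continuous _)).
apply: cvg_gmul => //; last exact/(gcompP GL).
- apply: (cvg_comp (fun z => orng (a z)) k _ (ck _ Da)).
  by apply: (cvg_comp _ _ ca); exact: orng_continuous.
- apply: (cvg_comp (fun z => orng (b z)) k' _ (ck' _ Db)).
  by apply: (cvg_comp _ _ cb); exact: orng_continuous.
- near=> z; apply/(gcompP GL).
  have Naz : N (a z) by near: z; apply: ca; exact: open_nbhs_nbhs.
  have Nbz : N' (b z) by near: z; apply: cb; exact: open_nbhs_nbhs.
  have [Daz kaz] := ND _ Naz; have [Dbz kbz] := ND' _ Nbz.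
  have cz : osrc (a z) = orng (b z) by near: z.
  by rewrite -osrc_class kaz -orng_class kbz.
Unshelve. all: by end_near.
Qed.

(** The quotient map is open and continuous, so it sends interiors of compact sets to open
    precompact sets. *)
Lemma orbit_precompact_cover (C : set (orbit_space G)) :
  hausdorff_space G -> locally_compact [set: G] -> compact C ->
  exists V, [/\ open V, precompact V & C `<=` V].
Proof.
move=> GH LC /compact_near_coveringP cC.
pose D0 := [set V : set (orbit_space G) | open V /\ precompact V].
(* The filter of tails of the open precompact sets ordered by inclusion, directed because these sets
   are stable under union. The near-covering form of compactness then turns local containment into a
   single [V] containing [C]. *)
pose F := filter_from D0 (fun V => [set W | V `<=` W /\ D0 W]).
have FF : Filter F.
  apply: filter_from_filter.
    exists set0; split; first exact: open0.
    by rewrite precompactE closure0; exact: compact0.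
  move=> V W [oV pV] [oW pW]; exists (V `|` W).
    split; first exact: openU.
    by move: pV pW; rewrite !precompactE closureU; exact: compactU.
  by move=> X [VWX D0X]; split; split => // x ?; apply: VWX; [left|right].
have [x Cx|V [oV pV] CV] := cC _ F (fun W x => W x) FF.
  have [K Kx [cK clK]] := LC (orbit_repr x) I.
  have {}Kx : K° (orbit_repr x) by rewrite /interior; near=> y; move: I; near: y; exact: Kx.
  have nx : nbhs x (@orbit_class G @` K°).
    apply: open_nbhs_nbhs; split; first by apply: orbit_class_open; exact: open_interior.
    by exists (orbit_repr x) => //; exact: orbit_reprK.
  exists (@orbit_class G @` K°, [set W | @orbit_class G @` K° `<=` W /\ D0 W]);
    last by move=> [y W] [/= ? [sW _]]; exact: sW.
  split => /=; first exact: nx.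
  - exists (@orbit_class G @` K°) => //; split.
      by apply: orbit_class_open; exact: open_interior.
    apply: (precompact_subset (B := @orbit_class G @` K)).
      by apply: image_subset; exact: interior_subset.
    apply: compact_precompact; first exact: orbit_hausdorff.
    apply: continuous_compact => //.
    by apply: continuous_subspaceT; exact: orbit_class_continuous.

by exists V; split => //; apply: (CV V); split => //; exact: subset_refl.
Unshelve. all: by end_near.
Qed.

End OrbitTopology.

(** * Bump functions and complex numbers *)

Lemma bump_exists (R : realType) (X : topologicalType) (x : X) (P : set X) :
  locally_compact [set: X] -> hausdorff_space X -> open P -> P x ->
  exists f : X -> R, [/\ continuous f, f x = 1,
    closure [set y | f y != 0] `<=` P & compact (closure [set y | f y != 0])].
Proof.
move=> LC HX oP Px.
have [K Kx [cK clK]] := LC x I.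
have {}Kx : K° x by rewrite /interior; near=> y; move: I; near: y; exact: Kx.
have := @locally_compact_completely_regular X R LC HX x (~` (P `&` K°)).
move=> /(_ (open_closedC (openI oP (@open_interior _ K))) (fun h => h (conj Px Kx))).
move=> /(uniform_separatorP (R := R)) [f [cf _ f0 f1]].
have fP y : 1 - f y != 0 -> P y /\ K° y.
  by apply: contra_neqP => nP; rewrite (f1 (f y)) ?subrr//; exists y.
(* [f] is 0 at [x] and 1 off the intersection of [P] with the interior of [K]. The closed support of
   [1 - f] could reach the boundary of that set; with the positive part of [1 - 2 * f] it stays in
   the closed set where f is at most 1/2, which lies inside. *)
pose t y : R^o := 1 - 2 * f y.
have tC : continuous t.
  move=> y; apply: cvgB; first exact: cvg_cst.
  by apply: cvgM; [exact: cvg_cst|exact: cf].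
have tP y : 0 <= t y -> P y /\ K° y.
  move=> ty; apply: fP; apply: contraTneq ty => /eqP.
  rewrite subr_eq0 /t => /eqP <-; rewrite mulr1 -ltNge.
  by rewrite subr_lt0 ltr1n.
have sub : closure [set y | Num.max (t y) 0 != 0] `<=` [set y | 0 <= t y].
  have cl : closed [set y | 0 <= t y].
    by apply: (@closed_comp _ _ t [set r | 0 <= r]); [move=> y _; exact: tC|exact: closed_ge].
  rewrite [X in _ `<=` X](closure_id _).1//; apply: closureS => y /=.
  by rewrite leNgt; apply: contra_neqN => /ltW ?; rewrite max_r.
exists (fun y => Num.max (t y) 0); split.
- by move=> y; apply: continuous_max; [exact: tC|exact: cvg_cst].
- by rewrite /t (f0 (f x)) ?mulr0 ?subr0 ?max_l//; exists x.
- by move=> y /sub/tP[].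
- apply: (subclosed_compact _ cK); first exact: closed_closure.
  by move=> y /sub/tP[_]; exact: interior_subset.
Unshelve. all: by end_near.
Qed.

Section Complex.
Variable R : realType.
Implicit Types z w : Cplx R.
Local Notation rc r := (r%:C%C : Cplx R).

Lemma real_complex1 : rc 1 = 1. Proof. by []. Qed.

Lemma normc_cabs z : `|z| = rc (cabs z).
Proof. by rewrite /cabs [in RHS]normc_def/= normc_def. Qed.

Lemma cabs_ge0 z : 0 <= cabs z.
Proof. by rewrite -ler0c -normc_cabs normr_ge0. Qed.

Lemma cabsM z w : cabs (z * w) = cabs z * cabs w.
Proof. by apply: complexI; rewrite rmorphM/= -!normc_cabs normrM. Qed.

Lemma cabsD z w : cabs (z + w) <= cabs z + cabs w.
Proof. by rewrite -lecR rmorphD/= -!normc_cabs ler_normD. Qed.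

Lemma cabsJ z : cabs z^* = cabs z.
Proof. by apply: complexI; rewrite -!normc_cabs norm_conjC. Qed.

Lemma cabsN z : cabs (- z) = cabs z.
Proof. by apply: complexI; rewrite -!normc_cabs normrN. Qed.

Lemma cabs_real (r : R) : 0 <= r -> cabs (rc r) = r.
Proof. by move=> r0; apply: complexI; rewrite -normc_cabs ger0_norm// ler0c. Qed.

Lemma Re_le_cabs z : `|complex.Re z| <= cabs z.
Proof.
rewrite /cabs normc_def/= -sqrtr_sqr ler_wsqrtr// lerDl sqr_ge0//.
Qed.

Lemma Im_le_cabs z : `|complex.Im z| <= cabs z.
Proof.
rewrite /cabs normc_def/= -sqrtr_sqr ler_wsqrtr// lerDr sqr_ge0//.
Qed.

Lemma cplx_pos (e : Cplx R) : 0 < e -> exists2 r : R, 0 < r & e = rc r.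
Proof.
case: e => a b; rewrite ltcE /= => /andP[/eqP -> a0]; by exists a.
Qed.

Lemma real_complex_continuous : continuous (fun r : R => rc r).
Proof.
move=> x; apply/cvgrPdist_lt => e /cplx_pos[r r0 ->].
near=> y.
rewrite -rmorphB/= normc_cabs ltcR.
have -> : cabs (rc (x - y)) = `|x - y|.
  by rewrite /cabs normc_def/= expr0n/= addr0 sqrtr_sqr.
near: y.
exact: cvgr_dist_lt.
Unshelve. all: by end_near.
Qed.

Lemma cplx_cvgP (Z : Type) (F : set_system Z) (FF : Filter F) (f : Z -> Cplx R) z :
  (forall e : R, 0 < e -> \forall t \near F, cabs (z - f t) < e) <-> f @ F --> z.
Proof.
split=> [h|/cvgrPdist_lt h e e0].
  apply/cvgrPdist_lt => e /cplx_pos[r r0 ->].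
  near=> t; rewrite normc_cabs ltcR; near: t; exact: h.
have /h : 0 < rc e by rewrite ltcR.
by apply: filterS => t; rewrite normc_cabs ltcR.
Unshelve. all: by end_near.
Qed.

Lemma cplx_neq0_nbhs z : z != 0 -> \forall w \near z, w != 0.
Proof.
move=> z0; apply: (@open_nbhs_nbhs (Cplx R) z [set w | w != 0]); split => //.
rewrite (_ : [set w | _] = ~` [set 0]); last by apply/seteqP; split=> w /eqP.
rewrite openC; apply: accessible_closed_set1; apply: hausdorff_accessible.
exact: norm_hausdorff.
Qed.

Lemma cplx_cauchy_cvg (u : nat -> Cplx R) :
  (forall e : R, 0 < e -> exists N, forall m n, (N <= m)%N -> (N <= n)%N ->
     cabs (u m - u n) < e) -> exists l : Cplx R, u @ \oo --> l.
Proof.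
move=> cu.
have real_part (p : Cplx R -> R) : (forall z w, p (z - w) = p z - p w) ->
    (forall z, `|p z| <= cabs z) -> exists a : R, p (u n) @[n --> \oo] --> a.
  move=> pB pn; apply/cvg_ex/cauchy_cvgP/cauchy_ballP => e e0.
  have [N hN] := cu e e0.
  near_simpl; near=> m n.
  rewrite /ball/= -pB; apply: (le_lt_trans (pn _)).
  by apply: hN; [near: m|near: n]; exact: nbhs_infty_ge.
have [||a ha] := real_part (@complex.Re R : Cplx R -> R).
- by move=> [? ?] [? ?].
- exact: Re_le_cabs.
have [||b hb] := real_part (@complex.Im R : Cplx R -> R).
- by move=> [? ?] [? ?].
- exact: Im_le_cabs.
exists (rc a + 'i%C * rc b).
have -> : u = (fun n => rc (complex.Re (u n)) + 'i%C * rc (complex.Im (u n))).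
  by apply/funext => n; rewrite -complexE.
apply: cvgD; first by apply: (cvg_comp _ _ ha); exact: real_complex_continuous.
apply: cvgM; first exact: cvg_cst.
by apply: (cvg_comp _ _ hb); exact: real_complex_continuous.
Unshelve. all: by end_near.
Qed.

End Complex.

(** * Haar systems on bundles of discrete groups *)

Section FiniteIntegral.
Context d (T : measurableType d) (R : realType) (mu : {measure set T -> \bar R}).
Hypothesis m1 : forall t : T, measurable [set t].

Lemma integral_seq (s : seq T) (c : R) (h : T -> R) : uniq s ->
  (forall x, x \in s -> mu [set x] = c%:E) ->
  (\int[mu]_(x in [set` s]) (h x)%:E = (c * \sum_(x <- s) h x)%:E)%E.
Proof.
elim: s => [_ _|x s IH /= /andP[xs us] hc].
  by rewrite set_nil integral_set0 big_nil mulr0.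
have hcs y : y \in s -> mu [set y] = c%:E.
  by move=> ys; apply: hc; rewrite inE ys orbT.
have fin (l : seq T) : finite_set [set` l] by exact: finite_seq.
have ms (l : seq T) : measurable [set` l].
  by apply: countable_measurable => //; exact: finite_set_countable.
have -> : [set` x :: s] = [set x] `|` [set` s].
  apply/seteqP; split=> y /=; rewrite inE.
    by move=> /predU1P.
  by move=> /predU1P.
rewrite integral_setU//; last 2 first.
- move=> mA Y mY; apply: countable_measurable => //.
  by apply/finite_set_countable/finite_setIl; rewrite finite_setU.
- by apply/disj_setPS => y [/= ->]; rewrite (negbTE xs).
rewrite IH// big_cons mulrDr EFinD; congr (_ + _)%E.
rewrite (@eq_integral _ _ _ _ _ (cst (h x)%:E)); last first.
  by move=> y; rewrite inE => ->.
rewrite integral_cst// hc ?inE ?eqxx//.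
by rewrite -EFinM mulrC.
Qed.

(** The integrand vanishes off finitely many points, and every subset of a finite set is measurable;
    hence [D] and [h] carry no measurability hypothesis. *)
Lemma integral_finite_support (D : set T) (c : R) (h : T -> R) :
  finite_set (D `&` h @^-1` [set~ 0]) ->
  (forall x, D x -> h x != 0 -> mu [set x] = c%:E) ->
  (\int[mu]_(x in D) (h x)%:E = (c * \sum_(x \in D) h x)%:E)%E.
Proof.
move=> fD hc; rewrite fsbig_supp.
set S := D `&` _.
have -> : (\int[mu]_(x in D) (h x)%:E = \int[mu]_(x in S) (h x)%:E)%E.
  rewrite integral_mkcond [RHS]integral_mkcond; apply: eq_integral => x _.
  rewrite /patch; case: ifPn => [|/negP xD]; case: ifPn => //.
    move=> /negP xS; rewrite inE => xD; have [->//|/eqP hx] := eqVneq (h x) 0.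
    by exfalso; apply: xS; rewrite inE.
  by rewrite inE => -[xD' _]; exfalso; apply: xD; rewrite inE.
rewrite fsbig_finite// -(integral_seq (c := c)) ?finmap.fset_uniq//; last first.
  by move=> x; rewrite in_fset_set// inE => -[Dx /eqP]; exact: hc.
rewrite [in LHS](_ : S = [set` finmap.enum_fset (fset_set S)])//.
by apply/seteqP; split => x /=; rewrite in_fset_set// inE.
Qed.

End FiniteIntegral.

Section GroupBundle.
Variables (R : realType) (A : groupoid) (nu : haar_system R A).
Hypothesis AL : groupoid_laws A.
Hypothesis As : forall a : A, gsrc a = grng a.
Hypothesis AH : hausdorff_space A.
Hypothesis AC : locally_compact [set: A].
Hypothesis rC : continuous (@grng A).
Hypothesis Ainj : forall a : A, exists U : set A,
  [/\ open U, U a & forall b c, U b -> U c -> grng b = grng c -> b = c].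
Local Notation rc r := (r%:C%C : Cplx R).
Implicit Types (f g : A -> Cplx R) (u : A).

Lemma closed_point (a : A) : closed [set a].
Proof. exact/accessible_closed_set1/hausdorff_accessible. Qed.

Lemma closed_gfiber u : closed (gfiber u).
Proof.
apply: (@closed_comp _ _ (@grng A) [set u]); last exact: closed_point.
by move=> a _; exact: rC.
Qed.

Lemma measurable_point u (a : borel u) : measurable [set a].
Proof.
rewrite -[X in measurable X]setCK; apply: measurableC.
apply: sub_sigma_algebra; rewrite /= openC; exact: closed_point.
Qed.

(** Each neighbourhood on which the range is injective meets the fibre in at most one point, and
    finitely many of them cover the compact part. *)
Lemma compact_gfiber_finite (K : set A) u : compact K -> finite_set (gfiber u `&` K).
Proof.
move=> cK; have /choice[U hU] := Ainj.
have : compact (gfiber u `&` K : set (pointed_at u)).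
  by rewrite setIC; apply: compact_closedI => //; exact: closed_gfiber.
rewrite compact_cover => /(_ A (gfiber u `&` K) U)[].
- by move=> a _; have [] := hU a.
- by move=> a [ra Ka]; exists a => //; have [] := hU a.
move=> D' D'sub cov; apply: (sub_finite_set _ (finite_fset D')).
move=> b [rb Kb]; have [a /= aD' Uab] := cov b (conj rb Kb).
have := D'sub _ aD'; rewrite inE => -[ra _].
have [_ Uaa inj] := hU a.
by rewrite (inj b a Uab Uaa)// rb ra.
Qed.

(** This is what sums over one fibre require of [f]. Unlike membership in [Cc], it passes to
    convolutions and adjoints by algebra alone, with no continuity argument. *)
Definition fiber_finite u f := finite_set (gfiber u `&` f @^-1` [set~ 0]).

Lemma Cc_fiber_finite u f : Cc f -> fiber_finite u f.
Proof.
move=> [_ /(compact_gfiber_finite u)]; apply: sub_finite_set => a [ra fa].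
by split=> //; apply: subset_closure; exact/eqP.
Qed.

Lemma fsum_additive (V : nmodType) (phi : {additive Cplx R -> V}) u f :
  fiber_finite u f ->
  phi (\sum_(a \in gfiber u) f a) = \sum_(a \in gfiber u) phi (f a).
Proof.
move=> ff; rewrite fsbig_supp/= fsbig_finite// raddf_sum/=.
rewrite -(fsbig_finite _ (fun a => phi (f a)))//; apply: fsbig_widen.
  by move=> a [].
move=> a [ra /not_andP[//|/contrapT fa]]; rewrite /= fa raddf0//.
Qed.

Lemma fsum_point u b f : gfiber u b -> (forall a, gfiber u a -> f a != 0 -> a = b) ->
  \sum_(a \in gfiber u) f a = f b.
Proof.
move=> rb fb; rewrite -(fsbig_widen [set b])/=; first exact: fsbig_set1.
  by move=> _ ->.
by move=> a [ra /= ab]; have [//|/(fb _ ra)] := eqVneq (f a) 0.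
Qed.

Lemma cint_fiber u f (c : R) : fiber_finite u f ->
  (forall a, grng a = u -> f a != 0 -> nu u [set a] = c%:E) ->
  cint (nu u) (gfiber u) f = rc c * \sum_(a \in gfiber u) f a.
Proof.
move=> ff hc; rewrite /cint.
have part (p : {additive Cplx R -> R}) :
    (\int[nu u]_(x in gfiber u) p (f x))%R = c * p (\sum_(a \in gfiber u) f a).
  have ff' : finite_set (gfiber u `&` (fun a => p (f a)) @^-1` [set~ 0]).
    apply: sub_finite_set ff => a [ra /= pa]; split=> // fa.
    by apply: pa; rewrite /= fa raddf0.
  rewrite /Rintegral (@integral_finite_support _ _ _ (nu u) (@measurable_point u)
    (gfiber u) c _ ff')/=.
    by rewrite fsum_additive.
  by move=> a ra pa; apply: hc => //; apply: contra_neq pa => ->; exact: raddf0.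
rewrite (part (@complex.Re R : {additive R[i] -> R})).
rewrite (part (@complex.Im R : {additive R[i] -> R})).
by case: (\sum_(_ \in _) _) => x y; simpc.
Qed.

Lemma haar_point_fin u a : gunits A u -> exists2 c : R, 0 <= c & nu u [set a] = c%:E.
Proof.
move=> uu; have := haar_compact nu uu (@compact_set1 _ a).
have p := measure_ge0 (nu u) [set a].
by rewrite -ge0_fin_numE// => /fineK E; exists (fine (nu u [set a])); rewrite ?E ?fine_ge0.
Qed.

Lemma bump_Cc (phi : A -> R) : continuous phi ->
  compact (closure [set y | phi y != 0]) -> Cc (fun a => rc (phi a)).
Proof.
move=> cphi kphi; split.
  move=> a; apply: (@continuous_comp _ _ _ phi (fun r => rc r)); first exact: cphi.
  exact: real_complex_continuous.
rewrite (_ : [set x | _] = [set y | phi y != 0])//.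
by apply/seteqP; split => a /=; apply: contra_neq; [move=> ->|move=> /complexI].
Qed.

(** Invariance under [a] is applied to a bump at [a] supported where the range is injective: on the
    fibre the bump sees only [a], and its translate sees only the unit [u]. *)
Lemma haar_point u a : gunits A u -> grng a = u -> nu u [set a] = nu u [set u].
Proof.
move=> uu ra.
have [U [oU Ua inj]] := Ainj a.
have [phi [cphi phia phiU kphi]] := bump_exists R AC AH oU Ua.
have {}phiU y : phi y != 0 -> U y by move=> ?; apply/phiU/subset_closure.
have Cphi := bump_Cc cphi kphi.
have [c c0 cE] := haar_point_fin a uu.
have [c' c'0 c'E] := haar_point_fin u uu.
have := haar_invariant nu a Cphi.
rewrite As ra.
have sing (b : A) f (e : R) : (forall x, gfiber u x -> f x != 0 -> x = b) ->
    gfiber u b -> f b = 1 -> nu u [set b] = e%:E -> cint (nu u) (gfiber u) f = rc e.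
  move=> fb rb fb1 eE; rewrite (cint_fiber (c := e)).
  - by rewrite (fsum_point rb)// fb1 mulr1.
  - apply: sub_finite_set (finite_set1 b) => x [rx /eqP]; exact: fb.
  - by move=> x rx /fb ->.
rewrite (sing u _ c') //.
- rewrite (sing a _ c) //.
  + by move=> /complexI; rewrite cE c'E => ->.
  + move=> x rx /= phix; apply: inj => //; last by rewrite rx.
    by apply: phiU; apply: contra_neq phix => ->.
  + by rewrite phia.
- move=> x rx /= phix.
  have sax : gsrc a = grng x by rewrite As ra rx.
  have axE : gmul a x = a.
    apply: inj => //; first by apply: phiU; apply: contra_neq phix => ->.
    exact: grng_mul.
  apply: (gmul_injl AL sax); first by rewrite As ra grng_unit.
  by rewrite axE -{1}(gsrc_mulr AL a) As ra.
- exact: grng_unit.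
- by rewrite -ra -As gsrc_mulr// phia.
Qed.

Definition haar_weight u : R := fine (nu u [set u]).

Lemma haar_weightE u a : gunits A u -> grng a = u -> nu u [set a] = (haar_weight u)%:E.
Proof.
move=> uu ra; rewrite haar_point// /haar_weight.
by have [c _ ->] := haar_point_fin u uu.
Qed.

(** An injectivity neighbourhood of [u] meets the fibre only in [u], and the complement of the fibre
    is null; so the positive mass of this neighbourhood sits at [u]. *)
Lemma haar_weight_gt0 u : gunits A u -> 0 < haar_weight u.
Proof.
move=> uu; have [U [oU Uu inj]] := Ainj u.
have [z p] := haar_supp nu uu.
have := p U oU (ex_intro _ u (conj Uu (grng_unit AL uu))).
rewrite -lte_fin -(haar_weightE uu (grng_unit AL uu)).
move=> /lt_le_trans; apply.
have mf : measurable (gfiber u : set (borel u)).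
  rewrite -[X in measurable X]setCK; apply: measurableC.
  apply: sub_sigma_algebra; rewrite /= openC; exact: closed_gfiber.
apply: (@le_trans _ _ (nu u ([set u] `|` ~` gfiber u))).
  apply: le_measure; rewrite ?inE.
  - exact: sub_sigma_algebra.
  - by apply: measurableU; [exact: measurable_point|exact: measurableC].
  move=> x Ux; have [rx|nrx] := pselect (grng x = u); [left|by right].
  by apply: inj => //; rewrite rx grng_unit.
rewrite -[leRHS]adde0 -[in leRHS]z.
by apply: measureU2; [exact: measurable_point|exact: measurableC].
Qed.

Lemma haar_sum u f : gunits A u -> fiber_finite u f ->
  cint (nu u) (gfiber u) f = rc (haar_weight u) * \sum_(a \in gfiber u) f a.
Proof. by move=> uu ff; apply: cint_fiber => // a ra _; exact: haar_weightE. Qed.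

(** A bump [phi] supported in the open unit space sees at most [v] in the fibre over a unit [v], so
    its integral there is the weight of [v] times [phi v]. This integral is continuous in [v], and
    [phi] can be divided out near [u], where it is nonzero. *)
Lemma haar_weight_cvg (Z : Type) (F : set_system Z) (FF : Filter F) (w : Z -> A) u :
  gunits A u -> (\forall z \near F, gunits A (w z)) -> w @ F --> u ->
  rc (haar_weight (w z)) @[z --> F] --> rc (haar_weight u).
Proof.
move=> uu nw cw.
have oA := open_gunits_of AL rC Ainj.
have [phi [cphi phiu phiU kphi]] := bump_exists R AC AH oA uu.
have {}phiU y : phi y != 0 -> gunits A y by move=> ?; apply/phiU/subset_closure.
have Cphi := bump_Cc cphi kphi.
pose j v := cint (nu v) (gfiber v) (fun a => rc (phi a)).
have /subspace_continuousP/(_ u uu) jC : {within gunits A, continuous j}.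
  exact: (@haar_continuous _ _ nu _ Cphi).
have J v : gunits A v -> j v = rc (haar_weight v) * rc (phi v).
  move=> uv; rewrite /j haar_sum//; last exact: Cc_fiber_finite.
  have rv : gfiber v v by exact: grng_unit.
  rewrite (fsum_point rv)// => x rx phix.
  by rewrite -rx; apply/esym/(grng_unit AL)/phiU; apply: contra_neq phix => ->.
have cphiw : rc (phi (w z)) @[z --> F] --> rc (phi u).
  apply: (cvg_comp (fun z => phi (w z)) (fun r => rc r));
    last exact: real_complex_continuous.
  by apply: (cvg_comp _ _ cw); exact: cphi.
move: j jC J => j jC J.
have cJ : j (w z) @[z --> F] --> j u.
  apply: (cvg_comp w j _ jC).
  move=> U; rewrite /within/= => nU.
  by have := cw _ nU; apply: filter_app; near=> z => /=; apply; near: z.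
rewrite (J u uu) phiu real_complex1 mulr1 in cJ.
rewrite -[X in _ --> X]mulr1 -[1 in X in _ --> X]invr1.
rewrite phiu real_complex1 in cphiw.
apply: (cvg_trans _ (cvgM cJ (cvgV (oner_neq0 _) cphiw))).
apply: near_eq_cvg.
have nphi : \forall z \near F, phi (w z) != 0.
  have : \forall v \near u, phi v != 0.
    have : nbhs (phi u) [set x : R | x != 0].
      by apply: open_nbhs_nbhs; rewrite phiu; split; [exact: open_neq|exact: oner_neq0].
    exact: cphi.
  exact: cw.
near=> z.
rewrite /= J; last by near: z.
have pz : phi (w z) != 0 by near: z.
rewrite -mulrA divff ?mulr1//.
by apply: contra_neq pz => /complexI.
Unshelve. all: by end_near.
Qed.

Definition fiber_pairing (chi : A -> Cplx R) u f :=
  cint (nu u) (gfiber u) (fun a => chi a * f a).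

(** * Characters of one fibre as multiplicative functionals *)

Section Character.
Variables (chi : A -> Cplx R) (u : A).
Hypothesis uu : gunits A u.
Hypothesis chi1 : forall a, grng a = u -> `|chi a| = 1.
Hypothesis chiM : forall a b, grng a = u -> grng b = u ->
  chi (gmul a b) = chi a * chi b.

Local Notation P := (fiber_pairing chi u).
Local Notation c := (rc (haar_weight u)).

Lemma fiber_finite_mul f : fiber_finite u f -> fiber_finite u (fun a => chi a * f a).
Proof.
apply: sub_finite_set => a [ra /= pa]; split=> // fa.
by apply: pa; rewrite /= fa mulr0.
Qed.

Lemma pairing_sum f : fiber_finite u f -> P f = c * \sum_(a \in gfiber u) chi a * f a.
Proof. by move=> ff; rewrite /fiber_pairing haar_sum//; exact: fiber_finite_mul. Qed.

Lemma fibM a b : grng a = u -> grng b = u -> grng (gmul a b) = u.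
Proof. by move=> ra rb; rewrite grng_mul// As ra. Qed.

Lemma fibV a : grng a = u -> grng (ginv a) = u.
Proof. by move=> ra; rewrite grngV// As. Qed.

Lemma fib_mulVK a b : grng a = u -> grng b = u -> gmul (ginv a) (gmul a b) = b.
Proof. by move=> ra rb; rewrite gmulVKe// As ra. Qed.

Lemma fib_mulKV a b : grng a = u -> grng b = u -> gmul a (gmul (ginv a) b) = b.
Proof. by move=> ra rb; rewrite gmulKVe// ra. Qed.

Lemma chiV a : grng a = u -> chi (ginv a) = (chi a)^*.
Proof.
move=> ra; have ca : chi a != 0 by rewrite -normr_eq0 chi1// oner_neq0.
have cu : chi u = 1.
  have ru : grng u = u by exact: grng_unit.
  have cu0 : chi u != 0 by rewrite -normr_eq0 chi1// oner_neq0.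
  apply: (mulfI cu0); rewrite mulr1 -chiM//; congr chi.
  by rewrite -[X in gmul X _]ru grng_mull.
have : chi a * chi (ginv a) = chi a * (chi a)^*.
  rewrite -chiM//; last exact: fibV.
  by rewrite -normCK chi1// expr1n -/(grng a) ra.
by move/(mulfI ca).
Qed.

Lemma fsum_reindex f (h k : A -> A) :
  (forall a, grng a = u -> grng (h a) = u /\ k (h a) = a) ->
  (forall a, grng a = u -> grng (k a) = u /\ h (k a) = a) ->
  \sum_(a \in gfiber u) f a = \sum_(a \in gfiber u) f (h a).
Proof.
move=> hk kh; apply: reindex_fsbig; split.
- by move=> a /hk[].
- by move=> a b; rewrite !inE => /hk[_ {2}<-] /hk[_ {2}<-] ->.
- by move=> a /kh[rk ha]; exists (k a).
Qed.

Lemma conv_fiber f g x : grng x = u -> fiber_finite u f ->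
  Defs.conv nu f g x = c * \sum_(y \in gfiber u) f y * g (gmul (ginv y) x).
Proof.
move=> rx ff; rewrite /Defs.conv rx haar_sum//.
apply: sub_finite_set ff => a [ra /= pa]; split=> // fa.
by apply: pa; rewrite /= fa mul0r.
Qed.

(** On the fibre, the support of the convolution lies in the product of the two supports. *)
Lemma conv_fiber_finite f g : fiber_finite u f -> fiber_finite u g ->
  fiber_finite u (Defs.conv nu f g).
Proof.
move=> ff fg.
apply: (sub_finite_set _ (finite_image2 (fun a b => gmul a b) ff fg)).
move=> x [rx /= cx].
have : exists y, gfiber u y /\ f y * g (gmul (ginv y) x) <> 0.
  apply: contrapT => /forallNP nex; apply: cx.
  rewrite conv_fiber// fsbig1 ?mulr0// => y ry.
  by apply: contrapT => h; apply: (nex y).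
move=> [y [ry fgy]]; exists y; first by split=> //= fy; apply: fgy; rewrite fy mul0r.
exists (gmul (ginv y) x).
  by split; [apply: fibM => //; exact: fibV|move=> /= gy; apply: fgy; rewrite gy mulr0].
exact: fib_mulKV.
Qed.

Lemma fsum_support f h (S : set A) : S `<=` gfiber u ->
  (forall a, gfiber u a -> ~ S a -> f a = 0) ->
  \sum_(a \in gfiber u) h a * f a = \sum_(a \in S) h a * f a.
Proof.
move=> Su fS; apply/esym/fsbig_widen => // a [ra nSa] /=.
by rewrite fS// mulr0.
Qed.

(** After exchanging the two sums and substituting x = y z in the fibre, multiplicativity of [chi]
    factors the double sum; the weight occurs squared on both sides. *)
Lemma pairing_conv f g : fiber_finite u f -> fiber_finite u g ->
  P (Defs.conv nu f g) = P f * P g.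
Proof.
move=> ff fg.
have fc := conv_fiber_finite ff fg.
rewrite !pairing_sum//.
rewrite mulrACA -mulrA; congr (_ * _).
(* The fibre may be infinite, so the sums are exchanged over finite index sets: the support [S] of
   [f], and the set [X] of products of points of [S] with points where [g] is nonzero. *)
pose S := gfiber u `&` f @^-1` [set~ 0].
pose X := gfiber u `&` [set x | exists2 y, S y & g (gmul (ginv y) x) != 0].
have Su : S `<=` gfiber u by move=> a [].
have Xu : X `<=` gfiber u by move=> a [].
have fS a : gfiber u a -> ~ S a -> f a = 0.
  by move=> ra nS; apply: contrapT => fa; apply: nS.
have finX : finite_set X.
  apply: (sub_finite_set _ (finite_image2 (fun a b => gmul a b) ff fg)).
  move=> x [rx /= [y Sy gy]]; have [ry _] := Sy; exists y => //.
  exists (gmul (ginv y) x); last exact: fib_mulKV.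
  by split; [apply: fibM => //; exact: fibV|exact/eqP].
have convE x : gfiber u x ->
    Defs.conv nu f g x = c * \sum_(y \in S) f y * g (gmul (ginv y) x).
  move=> rx; rewrite conv_fiber//; congr (_ * _).
  under eq_fsbigr do rewrite mulrC.
  by rewrite (fsum_support _ Su)//; under eq_fsbigr do rewrite mulrC.
have -> : \sum_(a \in gfiber u) chi a * Defs.conv nu f g a =
    \sum_(x \in X) chi x * Defs.conv nu f g x.
  apply: fsum_support => // x rx nX.
  rewrite convE// fsbig1 ?mulr0// => y Sy.
  have [->|gy] := eqVneq (g (gmul (ginv y) x)) 0; first by rewrite mulr0.
  by exfalso; apply: nX; split => //; exists y.
have -> : \sum_(x \in X) chi x * Defs.conv nu f g x =
    c * \sum_(x \in X) \sum_(y \in S) chi x * (f y * g (gmul (ginv y) x)).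
  rewrite mulr_fsumr; apply: eq_fsbigr => x; rewrite inE => -[rx _].
  rewrite convE// [LHS]mulrCA; congr (_ * _).
  by rewrite mulr_fsumr.
congr (_ * _).
rewrite exchange_fsbig//.
rewrite (fsum_support _ Su)// mulr_fsuml; apply: eq_fsbigr => y; rewrite inE => -[ry fy].
rewrite mulr_fsumr.
have -> : \sum_(x \in X) chi x * (f y * g (gmul (ginv y) x)) =
   \sum_(x \in gfiber u) chi x * (f y * g (gmul (ginv y) x)).
  apply/esym/fsum_support => // x rx nX.
  have [->|gy] := eqVneq (g (gmul (ginv y) x)) 0; first by rewrite mulr0.
  by exfalso; apply: nX; split => //; exists y.
rewrite (@fsum_reindex _ (gmul y) (gmul (ginv y))).
- apply: eq_fsbigr => z; rewrite inE => rz.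
  by rewrite chiM// fib_mulVK// mulrACA.
- by move=> z rz; rewrite fib_mulVK// fibM.
- by move=> z rz; rewrite fib_mulKV// fibM//; exact: fibV.
Qed.

Lemma gstar_fiber_finite f : fiber_finite u f -> fiber_finite u (gstar f).
Proof.
move=> ff; apply: (sub_finite_set _ (finite_image (@ginv A) ff)) => x [rx /= fx].
exists (ginv x); last exact: ginvK.
split; first exact: fibV.
by move=> /= f0; apply: fx; rewrite /gstar f0 rmorph0.
Qed.

Lemma pairing_gstar f : fiber_finite u f -> P (gstar f) = (P f)^*.
Proof.
move=> ff; have fs := gstar_fiber_finite ff.
rewrite !pairing_sum// rmorphM; congr (_ * _).
  exact/esym/conjc_real.
rewrite (@fsum_reindex _ (@ginv A) (@ginv A)).
- have := fsum_additive Num.conj (fiber_finite_mul ff); rewrite /= => ->.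
  apply: eq_fsbigr => a; rewrite inE => ra.
  by rewrite chiV// /gstar (ginvK AL) rmorphM.
- by move=> a ra; rewrite (ginvK AL) fibV.
- by move=> a ra; rewrite (ginvK AL) fibV.
Qed.

Lemma fiber_finiteD f g : fiber_finite u f -> fiber_finite u g -> fiber_finite u (f \+ g).
Proof.
move=> ff fg.
have : finite_set ((gfiber u `&` f @^-1` [set~ 0]) `|`
                   (gfiber u `&` g @^-1` [set~ 0])).
  by rewrite finite_setU.
apply: sub_finite_set => a [ra /= fga].
have [f0|/eqP f0] := eqVneq (f a) 0; [right|by left].
by split => // g0; apply: fga; rewrite f0 g0 addr0.
Qed.

Lemma fiber_finiteZ (k : Cplx R) f : fiber_finite u f -> fiber_finite u (fun a => k * f a).
Proof.
apply: sub_finite_set => a [ra /= fa]; split => // f0.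
by apply: fa; rewrite f0 mulr0.
Qed.

Lemma fiber_sumD (f g : A -> Cplx R) : fiber_finite u f -> fiber_finite u g ->
  \sum_(a \in gfiber u) (f a + g a) = \sum_(a \in gfiber u) f a + \sum_(a \in gfiber u) g a.
Proof.
move=> ff fg.
pose S := (gfiber u `&` f @^-1` [set~ 0]) `|` (gfiber u `&` g @^-1` [set~ 0]).
have fS : finite_set S by rewrite finite_setU.
have Su : S `<=` gfiber u by move=> a [[]|[]].
have f0 a : gfiber u a -> ~ S a -> f a = 0.
  by move=> ra nS; apply: contrapT => fa; apply: nS; left.
have g0 a : gfiber u a -> ~ S a -> g a = 0.
  by move=> ra nS; apply: contrapT => fa; apply: nS; right.
have w (h : A -> Cplx R) : (forall a, gfiber u a -> ~ S a -> h a = 0) ->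
    \sum_(a \in gfiber u) h a = \sum_(a \in S) h a.
  by move=> hS; apply/esym/fsbig_widen => // a [ra nSa]; exact: hS.
rewrite !w//; first exact: fsbig_split.
by move=> a ra nS; rewrite f0// g0// addr0.
Qed.

Lemma pairingD f g : fiber_finite u f -> fiber_finite u g -> P (f \+ g) = P f + P g.
Proof.
move=> ff fg; rewrite !pairing_sum//; last exact: fiber_finiteD.
rewrite -mulrDr -fiber_sumD//; try exact: fiber_finite_mul.
by congr (_ * _); apply: eq_fsbigr => a _; rewrite mulrDr.
Qed.

Lemma pairingZ (k : Cplx R) f : fiber_finite u f -> P (fun a => k * f a) = k * P f.
Proof.
move=> ff; rewrite !pairing_sum//; last exact: fiber_finiteZ.
rewrite [RHS]mulrCA; congr (_ * _); rewrite mulr_fsumr.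
by apply: eq_fsbigr => a _; rewrite mulrCA.
Qed.

Lemma cabs_fsum_le f : fiber_finite u f ->
  cabs (\sum_(a \in gfiber u) chi a * f a) <= \sum_(a \in gfiber u) cabs (f a).
Proof.
move=> ff; pose S := gfiber u `&` f @^-1` [set~ 0].
have Su : S `<=` gfiber u by move=> a [].
have fS a : gfiber u a -> ~ S a -> f a = 0.
  by move=> ra nS; apply: contrapT => fa; apply: nS.
rewrite (fsum_support _ Su)//.
have -> : \sum_(a \in gfiber u) cabs (f a) = \sum_(a \in S) cabs (f a).
  apply/esym/fsbig_widen => // a [ra nSa] /=; rewrite fS//.
  by rewrite (cabs_real (lexx 0)).
rewrite !fsbig_finite// -lecR -normc_cabs rmorph_sum/=.
apply: (le_trans (ler_norm_sum _ _ _)).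
rewrite big_seq [leRHS]big_seq; apply: ler_sum => a.
rewrite in_fset_set// inE => -[ra _].
by rewrite normrM chi1// mul1r normc_cabs.
Qed.

(** As [chi] is unimodular, the pairing is bounded by the integral of the modulus of [f] over the
    fibre, which is one of the terms of the first supremum in [Inorm]. *)
Lemma pairing_le_Inorm f : fiber_finite u f -> ((cabs (P f))%:E <= Inorm nu f)%E.
Proof.
move=> ff; rewrite /Inorm le_max; apply/orP; left.
apply: (@le_trans _ _ (\int[nu u]_(x in gfiber u) (cabs (f x))%:E)%E); last first.
  by apply: ereal_sup_ubound; exists u.
have ff' : finite_set (gfiber u `&` (fun a => cabs (f a)) @^-1` [set~ 0]).
  apply: sub_finite_set ff => a [ra /= pa]; split=> // fa.
  by apply: pa; rewrite /= fa (cabs_real (lexx 0)).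
have w0 := ltW (haar_weight_gt0 uu).
rewrite (@integral_finite_support _ _ _ (nu u) (@measurable_point u) (gfiber u)
  (haar_weight u) _ ff'); last first.
  by move=> a ra _; exact: haar_weightE.
rewrite lee_fin pairing_sum// cabsM cabs_real//.
by apply: ler_wpM2l => //; exact: cabs_fsum_le.
Qed.

Lemma pairing_seminorm : cstar_seminorm nu (fun f => cabs (P f)).
Proof.
have ffC f : Cc f -> fiber_finite u f by exact: Cc_fiber_finite.
split.
- by move=> f _; exact: cabs_ge0.
- by move=> f g /ffC ff /ffC fg; rewrite pairingD//; exact: cabsD.
- by move=> k f /ffC ff; rewrite pairingZ// cabsM.
- by move=> f g /ffC ff /ffC fg; rewrite pairing_conv// cabsM.
- move=> f /ffC ff; rewrite pairing_conv//; last exact: gstar_fiber_finite.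
  by rewrite pairing_gstar// cabsM cabsJ expr2.
- by move=> f /ffC ff; exact: pairing_le_Inorm.
Qed.

Lemma pairing_le_cstar_norm f : ((cabs (P f))%:E <= cstar_norm nu f)%E.
Proof. by apply: ereal_sup_ubound; exists (fun f => cabs (P f)) => //; exact: pairing_seminorm. Qed.

Lemma pairingB f g : fiber_finite u f -> fiber_finite u g ->
  P (f \- g) = P f - P g.
Proof.
move=> ff fg.
have -> : f \- g = f \+ (fun a => -1 * g a).
  by apply/funext => a /=; rewrite mulN1r.
by rewrite pairingD ?pairingZ ?mulN1r//; exact: fiber_finiteZ.
Qed.

End Character.

End GroupBundle.

(** * The isotropy groupoid *)

Lemma set_type_valP (X : Type) (S : set X) (a : set_type S) : S (val a).
Proof. by have := valP a; rewrite inE. Qed.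

Lemma val_insubd_set (X : eqType) (S : set X) (a : set_type S) x :
  S x -> val (insubd a x) = x.
Proof. by move=> Sx; rewrite insubdK// inE. Qed.

Section SetType.
Variables (X : topologicalType) (S : set X).

Lemma val_continuous : continuous (val : set_type S -> X).
Proof. exact: initial_continuous. Qed.

Lemma cvg_set_type (Z : Type) (F : set_system Z) (FF : Filter F)
    (f : Z -> set_type S) (a : set_type S) :
  val (f z) @[z --> F] --> val a -> f @ F --> a.
Proof.
move=> cf U [?/= [[W oW <-]] /= Wa /filterS]; apply; apply: cf.
exact: open_nbhs_nbhs.
Qed.

Lemma compact_set_type (K : set X) :
  compact (K `&` S) -> compact (val @^-1` K : set (set_type S)).
Proof.
move=> c F PF FK.
have FKS : (val @ F) (K `&` S).
  rewrite /fmap/= /nbhs/=; apply: (filterS (P := val @^-1` K)) FK => a /= Ka.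
  by split => //; exact: set_type_valP.
have [p [[Kp Sp] clp]] := c _ _ FKS.
exists (exist _ p (mem_set Sp)); split => //= U V FU.
move=> [?/= [[W oW <-]] /= Wp sV].
have [|q [[a Ua <-] Wa]] := clp (val @` U) W _ (open_nbhs_nbhs (conj oW Wp)).
  by rewrite /fmap/= /nbhs/=; apply: (filterS (P := U)) FU => a Ua; exists a.
by exists a; split => //; exact: sV.
Qed.

Lemma hausdorff_set_type : hausdorff_space X -> hausdorff_space (set_type S).
Proof.
move=> HX a b ab; apply: val_inj; apply: HX => U V nU nV.
have [z [zU zV]] := ab _ _ (val_continuous nU) (val_continuous nV).
by exists (val z).
Qed.

Lemma locally_compact_set_type : closed S -> locally_compact [set: X] ->
  locally_compact [set: set_type S].
Proof.
move=> cS LC a _; have [K Ka [cK clK]] := LC (val a) I.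
exists (val @^-1` K).
  have nK : nbhs (val a) K by near=> y; move: I; near: y; exact: Ka.
  have na : nbhs a (val @^-1` K : set (set_type S)) by exact: (val_continuous nK).
  rewrite -[within _ _ _]/(nbhs a [set b | setT b -> K (val b)]).
  by apply: filterS na => b Kb _.
split; first by apply: compact_set_type; exact: compact_closedI.
by apply: closed_comp => // b _; exact: val_continuous.
Unshelve. all: by end_near.
Qed.

End SetType.

Section Isotropy.
Variable G : groupoid.
Hypothesis GE : etale G.
Hypothesis GH : hausdorff_space G.
Hypothesis GC : locally_compact [set: G].
Let GT : topological_groupoid G := GE.1.
Let GL := tg_laws GT.
Let A := isotropy G.
Implicit Types a b : A.

Lemma isotropyP a : gsrc (val a) = grng (val a).
Proof. exact/esym/(set_type_valP a). Qed.

Lemma isotropy_mul a b : grng (val a) = grng (val b) ->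
  val (gmul a b) = gmul (val a) (val b).
Proof.
move=> ab; apply: val_insubd_set.
by rewrite /isotropy_set/= grng_mul ?gsrc_mul ?isotropyP.
Qed.

Lemma isotropy_inv a : val (ginv a) = ginv (val a).
Proof. by apply: val_insubd_set; rewrite /isotropy_set/= grngV// gsrcV// isotropyP. Qed.

Lemma isotropy_rng a : val (grng a) = grng (val a).
Proof. by rewrite /grng isotropy_mul// isotropy_inv// grngV// isotropyP. Qed.

Lemma isotropy_src a : gsrc a = grng a.
Proof.
apply: val_inj; rewrite isotropy_rng /gsrc isotropy_mul isotropy_inv ?grngV ?isotropyP//.
exact: isotropyP.
Qed.

Lemma isotropy_laws : groupoid_laws A.
Proof.
have cP a b : gcomp (a, b) <-> grng (val a) = grng (val b).
  by rewrite -isotropyP; exact: (gcompP GL (val a) (val b)).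
split.
- by move=> a; apply: val_inj; rewrite !isotropy_inv ginvK.
- move=> a b c /cP ab /cP bc; split.
  + by apply/cP; rewrite isotropy_mul// grng_mul ?isotropyP// ab.
  + by apply/cP; rewrite isotropy_mul// grng_mul ?isotropyP.
  + apply: val_inj; rewrite !isotropy_mul// ?grng_mul ?isotropyP// ?ab//.
    by rewrite gmulAe ?isotropyP.
- by move=> a; apply/cP; rewrite isotropy_inv grngV// isotropyP.
- move=> a b /cP ab; split; apply: val_inj.
    by rewrite !isotropy_mul ?isotropy_inv ?gmulVKe ?isotropyP ?grng_mul ?grngV ?isotropyP.
  by rewrite !isotropy_mul ?isotropy_inv ?gmulKe ?isotropyP ?grng_mul ?grngV ?isotropyP.
Qed.

Lemma isotropy_hausdorff : hausdorff_space A.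
Proof. exact: hausdorff_set_type. Qed.

Lemma closed_eq (X Y : topologicalType) (f g : X -> Y) : hausdorff_space Y ->
  continuous f -> continuous g -> closed [set x | f x = g x].
Proof.
move=> HY cf cg x clx; apply: HY => U V nU nV.
have /clx[y [/= fgy [Uy Vy]]] : nbhs x (f @^-1` U `&` g @^-1` V).
  by apply: filterI; [exact: cf|exact: cg].
by exists (f y); split => //; rewrite fgy.
Qed.

Lemma isotropy_locally_compact : locally_compact [set: A].
Proof.
apply: locally_compact_set_type => //; apply: closed_eq => //.
  exact: grng_continuous.
exact: gsrc_continuous.
Qed.

Lemma isotropy_rng_continuous : continuous (@grng A).
Proof.
move=> a.
have E : (fun z : A => val (grng z)) = @grng G \o val.
  by apply/funext => z; exact: isotropy_rng.
have c : (fun z : A => val (grng z)) @ a --> val (grng a).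
  rewrite E isotropy_rng; apply: continuous_comp; first exact: val_continuous.
  exact: grng_continuous.
exact: (@cvg_set_type _ _ _ (nbhs a) _ _ _ c).
Qed.

Lemma isotropy_inj_nbhs a : exists U : set A,
  [/\ open U, U a & forall b c, U b -> U c -> grng b = grng c -> b = c].
Proof.
have [U [oU Ua inj]] := range_inj_nbhs GE (val a).
exists (val @^-1` U); split => //.
  by apply: open_comp => // b _; exact: val_continuous.
move=> b c Ub Uc bc; apply: val_inj; apply: inj => //.
by rewrite -!isotropy_rng bc.
Qed.

Lemma isotropy_unitP a : gunits A a <-> gunits G (val a).
Proof.
rewrite (gunitsP isotropy_laws) (gunitsP GL) -isotropy_rng.
by split=> [->//|/val_inj].
Qed.

Lemma isotropy_fiberP u a : gunits A u -> grng a = u <-> stab (val u) (val a).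
Proof.
move=> uu; split=> [<-|[ra _]]; last by apply: val_inj; rewrite isotropy_rng.
by split; rewrite ?isotropyP isotropy_rng.
Qed.

End Isotropy.

(** * The dual of the isotropy groupoid *)

Lemma ptws_cvgP (I : Type) (V : topologicalType) (Z : Type) (F : set_system Z)
    (FF : Filter F) (h : Z -> {ptws I -> V}) (l : {ptws I -> V}) :
  h @ F --> l <-> forall i, h z i @[z --> F] --> l i.
Proof.
split=> [hl i|hl].
  apply: (cvg_comp h (fun g : {ptws I -> V} => g i)).
    exact: hl.
  have /cvg_sup/(_ i) h2 : nbhs l --> l by [].
  apply: (cvg_trans _ (@initial_continuous _ _ (fun g : I -> V => g i) l)).
  by apply: cvg_app; exact: h2.
apply/cvg_sup => i U [?/= [[W oW <-]] /= Wl /filterS]; apply.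
apply: hl; exact: open_nbhs_nbhs.
Qed.

Section Dual.
Variables (R : realType) (G : groupoid) (nu : haar_system R (isotropy G)).
Hypothesis GE : etale G.
Hypothesis GH : hausdorff_space G.
Hypothesis GC : locally_compact [set: G].
Let GT : topological_groupoid G := GE.1.
Let GL := tg_laws GT.
Local Notation A := (isotropy G).
Local Notation rc r := (r%:C%C : Cplx R).
Let AL := isotropy_laws GE.
Let As := isotropy_src GE.
Let AH := isotropy_hausdorff GH.
Let AC := isotropy_locally_compact GE GH GC.
Let rC := isotropy_rng_continuous GE.
Let Ai := isotropy_inj_nbhs GE.
Implicit Types (x y : dual nu) (f : A -> Cplx R) (F : cstar nu).

Lemma dual_charP x : stab_character (dual_char x) (dual_anchor x).
Proof.
have h : dual_set (val (x : dual_point R G)) := set_type_valP (x : set_type (@dual_set R G)).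
exact: h.
Qed.

Lemma dual_ext x y : dual_anchor x = dual_anchor y ->
  (forall g, stab (dual_anchor x) g -> dual_char x g = dual_char y g) -> x = y.
Proof.
move=> axy cxy; apply: val_inj.
rewrite [val x]surjective_pairing [val y]surjective_pairing; congr (_, _).
  apply/funext => g; rewrite -[LHS]/(dual_char x g) -[RHS]/(dual_char y g).
  have [sg|nsg] := pselect (stab (dual_anchor x) g); first exact: cxy.
  rewrite (char_out (dual_charP x) nsg); rewrite axy in nsg.
  by rewrite (char_out (dual_charP y) nsg).
exact: val_inj.
Qed.

Lemma dual_unitP x : gunits A (dual_unit x).
Proof. by apply/(isotropy_unitP GE); exact: char_unit (dual_charP x). Qed.

Definition iso_char x : A -> Cplx R := fun a => dual_char x (val a).

Lemma iso_char_norm x (a : A) : grng a = dual_unit x -> `|iso_char x a| = 1.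
Proof.
by move=> /(isotropy_fiberP GE _ (dual_unitP x)) sa; exact: char_norm (dual_charP x) _ sa.
Qed.

Lemma iso_charM x (a b : A) : grng a = dual_unit x -> grng b = dual_unit x ->
  iso_char x (gmul a b) = iso_char x a * iso_char x b.
Proof.
move=> ra rb; have /(isotropy_fiberP GE _ (dual_unitP x)) sa := ra.
have /(isotropy_fiberP GE _ (dual_unitP x)) sb := rb.
by rewrite /iso_char isotropy_mul ?sa.1 ?sb.1// (charM (dual_charP x) sa sb).
Qed.

Lemma dual_pairingE x f : dual_pairing nu x f = fiber_pairing nu (iso_char x) (dual_unit x) f.
Proof. by []. Qed.

Lemma dual_pairing_le x f : ((cabs (dual_pairing nu x f))%:E <= cstar_norm nu f)%E.
Proof.
rewrite dual_pairingE; apply: (pairing_le_cstar_norm nu AL As AH AC rC Ai) => //.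
- exact: dual_unitP.
- exact: iso_char_norm.
- exact: iso_charM.
Qed.

Let CF u f : Cc f -> fiber_finite u f := @Cc_fiber_finite _ _ AH rC Ai u f.

Lemma dual_pairingB x F m n :
  dual_pairing nu x (F m) - dual_pairing nu x (F n) = dual_pairing nu x (F m \- F n).
Proof.
rewrite !dual_pairingE (pairingB nu AL As AH AC Ai _ (dual_unitP x))//; apply: CF; exact: cstar_Cc.
Qed.

(** The index depends on [F] alone: differences of pairings are dominated by [cstar_norm] whatever
    the character, so the Cauchy condition is uniform in [x]. *)
Lemma dual_eval_approx F (e : R) : 0 < e ->
  exists n, forall x, cabs (@dual_eval R G nu x F - dual_pairing nu x (F n)) < e.
Proof.
move=> e0; have e20 : 0 < e / 2 by rewrite divr_gt0.
have cau x (r : R) : 0 < r -> exists N, forall m n, (N <= m)%N -> (N <= n)%N ->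
    cabs (dual_pairing nu x (F m) - dual_pairing nu x (F n)) < r.
  move=> /(cstar_cauchy F)[N hN]; exists N => m n Nm Nn.
  rewrite dual_pairingB -lte_fin; exact: le_lt_trans (dual_pairing_le _ _) (hN m n Nm Nn).
have [N hN] := cstar_cauchy F e20.
exists N => x; have [l hl] := cplx_cauchy_cvg (cau x).
have -> : @dual_eval R G nu x F = l by apply: cvg_lim => //; exact: norm_hausdorff.
have /cplx_cvgP/(_ _ e20) nl := hl.
(* Here [m] may depend on [x], while [N] does not: [F m] brings the pairing close to its limit, and
   the Cauchy bound covers the step from [F m] to [F N]. *)
near \oo => m.
rewrite -(subrK (dual_pairing nu x (F m)) l) -addrA [e]splitr.
apply: (le_lt_trans (cabsD _ _)); apply: ltrD; first by near: m.
rewrite dual_pairingB -lte_fin; apply: (le_lt_trans (dual_pairing_le _ _)).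
apply: hN => //; near: m; exact: nbhs_infty_ge.
Unshelve. all: by end_near.
Qed.

(* All the functionals are bounded by the same norm, so that convergence only has
   to be tested on compactly supported functions. *)
Lemma dual_cvg (Z : Type) (E : set_system Z) (FE : Filter E) (h : Z -> dual nu) x :
  (forall f, Cc f -> dual_pairing nu (h z) f @[z --> E] --> dual_pairing nu x f) ->
  h @ E --> x.
Proof.
move=> hx.
have : @dual_eval R G nu (h z) @[z --> E] --> @dual_eval R G nu x.
  apply/ptws_cvgP => F; apply/cplx_cvgP => e e0.
  have e30 : 0 < e / 3 by rewrite divr_gt0.
  have [n hn] := dual_eval_approx F e30.
  have /cplx_cvgP/(_ _ e30) nx := hx _ (cstar_Cc F n).
  near=> z.
  have -> : e = e / 3 + (e / 3 + e / 3) by field.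
  have tel (a b p q : Cplx R) : a - b = (a - p) + ((p - q) - (b - q)) by ring.
  rewrite (tel _ _ (dual_pairing nu x (F n)) (dual_pairing nu (h z) (F n))).
  apply: (le_lt_trans (cabsD _ _)); apply: ltrD; first exact: hn.
  apply: (le_lt_trans (cabsD _ _)); apply: ltrD; first by near: z.
  by rewrite cabsN; exact: hn.
move=> c U [?/= [[W oW <-]] /= Wx /filterS]; apply.
apply: c; exact: open_nbhs_nbhs.
Unshelve. all: by end_near.
Qed.

Lemma cstar_norm0 f (e : R) : Cc f -> 0 < e -> (cstar_norm nu (f \- f)%R < e%:E)%E.
Proof.
move=> Cf e0; apply: (@le_lt_trans _ _ 0%E); last by rewrite lte_fin.
apply: ge_ereal_sup => _ [p pP <-].
have -> : f \- f = (fun a => 0 * f a).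
  by apply/funext => a /=; rewrite mul0r subrr.
by rewrite (csnZ pP)// (cabs_real (lexx 0)) mul0r.
Qed.

Definition cstar_cst f (Cf : Cc f) : cstar nu :=
  @CStarElt _ _ nu (fun=> f) (fun=> Cf)
    (fun e e0 => ex_intro _ 0%N (fun _ _ _ _ => cstar_norm0 Cf e0)).

(** The constant sequence [f] is an element of the completion whose evaluation is the pairing with
    [f], hence one of the coordinates that define the topology. *)
Lemma dual_pairing_continuous f : Cc f -> continuous (fun x => dual_pairing nu x f).
Proof.
move=> Cf x.
have E y : dual_pairing nu y f = @dual_eval R G nu y (cstar_cst Cf).
  apply/esym/(@cvg_lim (Cplx R)); first exact: norm_hausdorff.
  exact: (cvg_cst (dual_pairing nu y f)).
under eq_fun do rewrite E.
have /ptws_cvgP : @dual_eval R G nu y @[y --> x] --> @dual_eval R G nu x.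
  exact: initial_continuous.
by move=> /(_ (cstar_cst Cf)); apply.
Qed.

Lemma dual_pairing_sum x f : Cc f -> dual_pairing nu x f =
  rc (haar_weight nu (dual_unit x)) * \sum_(a \in gfiber (dual_unit x)) iso_char x a * f a.
Proof.
move=> Cf; rewrite dual_pairingE (pairing_sum nu AL As AH AC Ai _ (dual_unitP x))//.
exact: CF.
Qed.

Lemma weight_neq0 x : rc (haar_weight nu (dual_unit x)) != 0.
Proof.
have := haar_weight_gt0 nu AL As AH AC rC Ai (dual_unitP x).
by rewrite lt0r => /andP[+ _]; apply: contra_neq => /complexI.
Qed.

(** A bump supported where the range is injective singles out one point of a fibre; pairing with it
    reads off a character at that point, up to the weight. *)
Lemma pairing_bump (a : A) (U : set A) : open U -> U a ->
  exists f : A -> Cplx R, [/\ Cc f, f a = 1, forall b, f b != 0 -> U b &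
    forall x, grng a = dual_unit x ->
      dual_pairing nu x f = rc (haar_weight nu (dual_unit x)) * iso_char x a].
Proof.
move=> oU Ua; have [V [oV Va inj]] := Ai a.
have [phi [cphi phia sub kphi]] := bump_exists R AC AH (openI oU oV) (conj Ua Va).
have {}sub b : rc (phi b) != 0 -> U b /\ V b.
  by move=> pb; apply/sub/subset_closure; apply: contra_neq pb => ->.
have Cphi := bump_Cc cphi kphi.
exists (fun b => rc (phi b)); split => //.
- by rewrite phia.
- by move=> b /sub[].
move=> x ra; rewrite dual_pairing_sum//; congr (_ * _).
rewrite (fsum_point ra) ?phia ?mulr1// => b rb.
rewrite mulf_eq0 negb_or => /andP[_ /sub[_ Vb]].
by apply: inj => //; rewrite ra.
Qed.

Lemma iso_char_neq0 x (a : A) : grng a = dual_unit x -> iso_char x a != 0.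
Proof. by move=> ra; rewrite -normr_eq0 iso_char_norm// oner_neq0. Qed.

(** The test function is a bump supported on units in [V]. Its pairing is nonzero at [x], hence at
    every nearby [y], where it sees only the unit of [y]; that unit must therefore lie in [V]. *)
Lemma dual_anchor_continuous : continuous (fun x => dual_anchor x).
Proof.
move=> x U; rewrite nbhsE => -[V [oV Vx] VU].
have oW : open ((val : A -> G) @^-1` V `&` gunits A).
  apply: openI; first by apply: open_comp => // a _; exact: val_continuous.
  exact: open_gunits_of AL rC Ai.
have [f [Cf _ fW fx]] := pairing_bump oW (conj Vx (dual_unitP x)).
have ux : grng (dual_unit x) = dual_unit x by apply: grng_unit => //; exact: dual_unitP.
have np : \forall y \near x, dual_pairing nu y f != 0.
  have : nbhs (dual_pairing nu x f) [set z | z != 0].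
    by apply: cplx_neq0_nbhs; rewrite fx// mulf_neq0 ?weight_neq0 ?iso_char_neq0.
  exact: (dual_pairing_continuous Cf).
suff : \forall y \near x, U (dual_anchor y) by [].
near=> y; apply: contrapT => nVy.
have /eqP : dual_pairing nu y f != 0 by near: y.
apply; rewrite dual_pairing_sum// fsbig1 ?mulr0// => a ra.
have [->|/fW[Va ua]] := eqVneq (f a) 0; first by rewrite mulr0.
exfalso; apply: nVy; apply: VU; rewrite /= /dual_anchor -ra.
by rewrite (grng_unit AL ua).
Unshelve. all: by end_near.
Qed.

(** Continuity of the anchor separates different units. Over one unit the pairings with bumps
    recover the character, because the weight is nonzero. *)
Lemma dual_hausdorff : hausdorff_space (dual nu).
Proof.
move=> x y xy.
have axy : dual_anchor x = dual_anchor y.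
  apply: GH => U V nU nV.
  have [z [zU zV]] := xy _ _ (dual_anchor_continuous nU) (dual_anchor_continuous nV).
  by exists (dual_anchor z).
have uxy : dual_unit x = dual_unit y by apply: val_inj.
have pxy f : Cc f -> dual_pairing nu x f = dual_pairing nu y f.
  move=> Cf; apply: (@norm_hausdorff _ (Cplx R)) => U V nU nV.
  have [z [zU zV]] := xy _ _ (dual_pairing_continuous Cf nU) (dual_pairing_continuous Cf nV).
  by exists (dual_pairing nu z f).
apply: dual_ext => // g sg.
have ig : isotropy_set G g by rewrite /isotropy_set/= sg.1 sg.2.
pose a : A := exist _ g (mem_set ig).
have rax : grng a = dual_unit x by apply/(isotropy_fiberP GE _ (dual_unitP x)).
have [f [Cf _ _ fE]] := pairing_bump openT (I : [set: A] a).
have := pxy f Cf; rewrite fE// fE -?uxy//.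
by move/(mulfI (weight_neq0 x)).
Qed.

(** Stability groups are discrete since the range is locally injective. This settles the continuity
    clause of [stab_character] for conjugated characters. *)
Lemma stab_discrete_continuous (u : G) (f : G -> Cplx R) :
  {within stab u, continuous f}.
Proof.
apply/subspace_continuousP => a [ra sa] W nW.
have [U [oU Ua inj]] := range_inj_nbhs GE a.
have nU : \forall b \near a, U b by exact: open_nbhs_nbhs.
suff : \forall b \near a, stab u b -> W (f b) by [].
near=> b => -[rb sb].
have -> : b = a by apply: inj => //; [near: b|rewrite rb].
exact: nbhs_singleton nW.
Unshelve. all: by end_near.
Qed.

(** * The action of [G] on the dual *)

Definition act_char x (g a : G) : Cplx R :=
  if `[< stab (gsrc g) a >] then dual_char x (gmul (gmul g a) (ginv g)) else 0.

Lemma act_charE x g a : stab (gsrc g) a -> act_char x g a = dual_char x (gconj (ginv g) a).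
Proof. by move=> sa; rewrite /act_char asboolT// /gconj (ginvK GL). Qed.

Lemma stab_conjV (g a : G) : stab (gsrc g) a -> stab (grng g) (gconj (ginv g) a).
Proof. by rewrite -(grngV GL) -(gsrcV GL g) => /(stab_conj GL). Qed.

Lemma act_charP x g : grng g = dual_anchor x -> stab_character (act_char x g) (gsrc g).
Proof.
move=> rg; have cx := dual_charP x; rewrite -rg in cx.
split.
- exact: gunits_src.
- by move=> a nsa; rewrite /act_char asboolF.
- by move=> a sa; rewrite act_charE// (char_norm cx)//; exact: stab_conjV.
- move=> a b sa sb; rewrite !act_charE//; last exact: stabM.
  have rV : grng (ginv g) = gsrc g by exact: grngV.
  by rewrite (gconjM GL) ?rV// (charM cx (stab_conjV sa) (stab_conjV sb)).
- exact: stab_discrete_continuous.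
Qed.

Lemma dual_actE x g : grng g = dual_anchor x ->
  val (dual_act x g) = (act_char x g, insubd (dual_unit x) (gsrc g)).
Proof.
move=> rg; apply: val_insubd_set; rewrite /dual_set/= val_insubd_set.
  exact: act_charP.
by rewrite /isotropy_set/= grng_src// gsrc_src.
Qed.

Lemma dual_act_anchor x g : grng g = dual_anchor x -> dual_anchor (dual_act x g) = gsrc g.
Proof.
move=> rg; rewrite /dual_anchor /dual_unit dual_actE//= val_insubd_set//.
by rewrite /isotropy_set/= grng_src// gsrc_src.
Qed.

Lemma dual_act_char x g a : grng g = dual_anchor x -> stab (gsrc g) a ->
  dual_char (dual_act x g) a = dual_char x (gconj (ginv g) a).
Proof. by move=> rg sa; rewrite /dual_char dual_actE//= act_charE. Qed.

Lemma dual_act_unit x : dual_act x (dual_anchor x) = x.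
Proof.
have ux := char_unit (dual_charP x).
have rx : grng (dual_anchor x) = dual_anchor x by exact: grng_unit.
have sx : gsrc (dual_anchor x) = dual_anchor x by exact: gsrc_unit.
apply: (@dual_ext (dual_act x (dual_anchor x) : dual nu)); first by rewrite dual_act_anchor.
rewrite dual_act_anchor// => a sa; rewrite dual_act_char//; congr dual_char.
rewrite sx in sa; have [ra sa'] := sa.
rewrite /gconj (ginvK GL) (ginv_unit GL)//.
by rewrite -[X in gmul (gmul X _) _]ra grng_mull// -sa' gsrc_mulr.
Qed.

Lemma dual_act_mul x g h : grng g = dual_anchor x -> gsrc g = grng h ->
  dual_act (dual_act x g) h = dual_act x (gmul g h).
Proof.
move=> rg gh.
have rh : grng h = dual_anchor (dual_act x g) by rewrite dual_act_anchor.
have rgh : grng (gmul g h) = dual_anchor x by rewrite grng_mul.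
have sgh : gsrc (gmul g h) = gsrc h by rewrite gsrc_mul.
apply: (@dual_ext (dual_act (dual_act x g) h : dual nu)).
  by rewrite !dual_act_anchor.
rewrite dual_act_anchor// => a sa; rewrite !dual_act_char ?sgh//.
  by rewrite ginv_mul// gconj_comp// ?gsrcV ?grngV.
by rewrite gh; exact: stab_conjV.
Qed.

Lemma dual_act_eq x g h : abelian_stab G -> grng g = dual_anchor x ->
  grng g = grng h -> gsrc g = gsrc h -> dual_act x g = dual_act x h.
Proof.
move=> ab rg r s; have rh : grng h = dual_anchor x by rewrite -r.
apply: (@dual_ext (dual_act x g : dual nu)); first by rewrite !dual_act_anchor.
rewrite dual_act_anchor// => a sa; rewrite !dual_act_char -?s//; congr dual_char.
by apply: gconj_abelian => //; rewrite ?grngV ?gsrcV.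
Qed.

(** * Continuity of the action along a local section *)

Section Action.
Variables (D : set G) (k : G -> G).
Hypothesis oD : open D.
Hypothesis kD : forall u, D u -> grng (k u) = u.
Hypothesis kC : forall u, D u -> {for u, continuous k}.

(** Its values matter only over [D]: there [k u] has range [u], the conjugate is an isotropy
    element, and the default [b] does not occur. *)
Definition conj_section (b : A) : A := insubd b (gconj (k (grng (val b))) (val b)).

Lemma isotropy_stab (b : A) : stab (grng (val b)) (val b).
Proof. by split => //; exact: isotropyP. Qed.

Lemma conj_sectionE (b : A) : D (grng (val b)) ->
  val (conj_section b) = gconj (k (grng (val b))) (val b).
Proof.
move=> Db; apply: val_insubd_set.
have [] : stab (gsrc (k (grng (val b)))) (gconj (k (grng (val b))) (val b)).
  by apply: (stab_conj GL); rewrite kD//; exact: isotropy_stab.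
by rewrite /isotropy_set/= => -> ->.
Qed.

Lemma grng_val_continuous : continuous (fun b : A => grng (val b)).
Proof.
move=> b; apply: continuous_comp; first exact: val_continuous.
exact: grng_continuous.
Qed.

Lemma conj_section_continuous (b : A) : D (grng (val b)) ->
  {for b, continuous conj_section}.
Proof.
move=> Db.
have nD : \forall c \near b, D (grng (val c)).
  exact/grng_val_continuous/open_nbhs_nbhs.
suff c : (fun c : A => val (conj_section c)) @ b --> val (conj_section b).
  exact: (@cvg_set_type _ _ _ (nbhs b) _ _ _ c).
rewrite conj_sectionE//.
have E : {near nbhs b, (fun c : A => gconj (k (grng (val c))) (val c)) =1
    (fun c => val (conj_section c))}.
  by near=> c; rewrite conj_sectionE//; near: c.
apply: (cvg_trans (near_eq_cvg E)).
apply: (gconj_cvg GT).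
- apply: (cvg_comp (fun c : A => grng (val c)) k); last exact: kC.
  exact: grng_val_continuous.
- exact: val_continuous.
- by near=> c; rewrite kD; [exact: isotropy_stab|near: c].
- by rewrite kD//; exact: isotropy_stab.
Unshelve. all: by end_near.
Qed.

Section Pullback.
Variable phi : G -> R.
Hypothesis phiC : continuous phi.
Hypothesis phiD : closure [set u | phi u != 0] `<=` D.
Hypothesis phiK : compact (closure [set u | phi u != 0]).

(** The factor [phi], supported in [D], extends the composite by zero beyond the domain of the
    section and keeps its support compact. *)
Definition pullback f : A -> Cplx R :=
  fun b => rc (phi (grng (val b))) * f (conj_section b).

(** Over [D] this is a product of continuous functions. Elsewhere the range avoids the closed
    support of [phi], so the function vanishes on a neighbourhood. *)
Lemma pullback_continuous f : continuous f -> continuous (pullback f).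
Proof.
move=> fC b.
have pC : (fun c : A => rc (phi (grng (val c)))) @ b --> rc (phi (grng (val b))).
  apply: (cvg_comp (fun c : A => phi (grng (val c))) (fun r => rc r));
    last exact: real_complex_continuous.
  apply: (cvg_comp (fun c : A => grng (val c)) phi); last exact: phiC.
  exact: grng_val_continuous.
have [Db|nDb] := pselect (D (grng (val b))).
  have cC : (fun c => f (conj_section c)) @ b --> f (conj_section b).
    apply: (cvg_comp conj_section f); last exact: fC.
    exact: conj_section_continuous.
  exact: (cvgM pC cC).
have p0 u : ~ closure [set u | phi u != 0] u -> phi u = 0.
  by move=> nu'; apply/eqP; apply: contra_notT nu' => pu; exact: subset_closure.
have nb : \forall c \near b, ~ closure [set u | phi u != 0] (grng (val c)).
  have n0 : nbhs (grng (val b)) (~` closure [set u | phi u != 0]).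
    apply: open_nbhs_nbhs; split; first by rewrite openC; exact: closed_closure.
    by move=> /phiD.
  exact: grng_val_continuous n0.
have E : {near nbhs b, (fun c : A => 0 : Cplx R) =1 pullback f}.
  by near=> c; rewrite /pullback p0 ?mul0r//; near: c.
apply: (cvg_trans (near_eq_cvg E)).
rewrite /pullback p0 ?mul0r; last by move=> /phiD.
exact: cvg_cst.
Unshelve. all: by end_near.
Qed.

Lemma closed_isotropy : closed (isotropy_set G).
Proof.
by apply: closed_eq => //; [exact: grng_continuous|exact: gsrc_continuous].
Qed.

Lemma pullback_Cc f : Cc f -> Cc (pullback f).
Proof.
move=> [fC fK]; split; first exact: pullback_continuous.
(* Undoing the conjugation, a point of the support has the form g a g^-1 with [g] in the image under
   [k] of the support of [phi], and [a] in the support of [f]. [C] consists of the pairs for which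
   this product makes sense; it is compact, and so is its image [E]. *)
pose C := ((k @` closure [set u | phi u != 0]) `*` ((val : A -> G) @` closure [set a | f a != 0]))
  `&` [set p : G * G | gsrc p.1 = grng p.2].
have CK : compact C.
  apply: compact_closedI.
    apply: compact_setX; apply: continuous_compact => //.
      by apply: continuous_in_subspaceT => u; rewrite inE => /phiD; exact: kC.
    by apply: continuous_subspaceT; exact: val_continuous.
  apply: closed_eq => // p; apply: continuous_comp.
  - exact: cvg_fst.
  - exact: gsrc_continuous.
  - exact: cvg_snd.
  - exact: grng_continuous.
have Cstab p : C p -> stab (grng (ginv p.1)) p.2.
  move=> [[_ [a _ pa]] E]; rewrite grngV// (_ : gsrc p.1 = grng p.2)// -pa.
  exact: isotropy_stab.
pose E := (fun p : G * G => gconj (ginv p.1) p.2) @` C.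
have EK : compact E.
  apply: continuous_compact => //; apply/subspace_continuousP => p Cp.
  apply: (gconj_cvg GT).
  - apply: (cvg_comp (fun q : G * G => q.1) (@ginv G)); last exact: tg_inv.
    apply: (cvg_trans _ (@cvg_fst _ _ (nbhs p.1) (nbhs p.2) _)); apply: cvg_app.
    exact: cvg_within.
  - apply: (cvg_trans _ (@cvg_snd _ _ (nbhs p.1) (nbhs p.2) _)); apply: cvg_app.
    exact: cvg_within.
  - by apply: (filterS (P := C)); [exact: Cstab|exact: withinT].
  - exact: Cstab.
have EA : compact (val @^-1` E : set A).
  by apply: compact_set_type; apply: compact_closedI => //; exact: closed_isotropy.
rewrite -precompactE; exists (val @^-1` E : set A); last first.
  by split; [exact: EA|exact: (compact_closed AH EA)].
move=> b /=; rewrite /pullback mulf_eq0 negb_or => /andP[pb fb].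
have pb' : closure [set u | phi u != 0] (grng (val b)).
  by apply: subset_closure; apply: contra_neq pb => ->.
exists (k (grng (val b)), val (conj_section b)).
  split; first split.
  - by exists (grng (val b)).
  - by exists (conj_section b) => //; exact: subset_closure.
  - rewrite /= conj_sectionE//; last exact: phiD.
    have [] : stab (gsrc (k (grng (val b)))) (gconj (k (grng (val b))) (val b)) => //.
    by apply: (stab_conj GL); rewrite kD; [exact: isotropy_stab|exact: phiD].
rewrite /= conj_sectionE//; last exact: phiD.
by apply: (gconjVK GL); rewrite kD; [exact: isotropy_stab|exact: phiD].
Qed.

Lemma conj_section_bij x : D (dual_anchor x) ->
  let y := dual_act x (k (dual_anchor x)) : dual nu in
  set_bij (gfiber (dual_unit x)) (gfiber (dual_unit y)) conj_section.
Proof.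
move=> Dx /=; set w := dual_anchor x in Dx *; set y := dual_act x (k w) : dual nu.
have rk : grng (k w) = w by exact: kD.
have ay : dual_anchor y = gsrc (k w) by exact: dual_act_anchor.
have fx (b : A) : gfiber (dual_unit x) b <-> stab w (val b).
  exact: (isotropy_fiberP GE _ (dual_unitP x)).
have fy (b : A) : gfiber (dual_unit y) b <-> stab (gsrc (k w)) (val b).
  by rewrite -ay; exact: (isotropy_fiberP GE _ (dual_unitP y)).
have cE (b : A) : stab w (val b) -> val (conj_section b) = gconj (k w) (val b).
  by move=> [rb _]; rewrite conj_sectionE rb.
split.
- move=> b /fx sb; apply/fy; rewrite cE//.
  by apply: (stab_conj GL); rewrite rk.
- move=> b c; rewrite !inE => /fx sb /fx sc /(congr1 val); rewrite !cE// => bc.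
  apply: val_inj; rewrite -(@gconjVK _ GL (k w) (val b)) ?rk// bc.
  by rewrite (gconjVK GL) ?rk.
- move=> a /fy sa.
  have sb := stab_conjV sa; rewrite rk in sb.
  have ib : isotropy_set G (gconj (ginv (k w)) (val a)).
    by rewrite /isotropy_set/= sb.1 sb.2.
  have vb := val_insubd_set a ib.
  exists (insubd a (gconj (ginv (k w)) (val a))); first by apply/fx; rewrite vb.
  by apply: val_inj; rewrite cE vb// (gconjK GL).
Qed.

(** Conjugation reindexes the sum over the fibre of [y] by the fibre of [x]. The Haar weights of the
    two fibres may differ, so each side is multiplied by the weight it lacks. *)
Lemma act_pairing x f : D (dual_anchor x) -> Cc f ->
  let y := dual_act x (k (dual_anchor x)) : dual nu in
  rc (haar_weight nu (dual_unit x)) * (rc (phi (dual_anchor x)) * dual_pairing nu y f) =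
  rc (haar_weight nu (dual_unit y)) * dual_pairing nu x (pullback f).
Proof.
move=> Dx Cf y; have Cf' := pullback_Cc Cf.
have bij : set_bij (gfiber (dual_unit x)) (gfiber (dual_unit y)) conj_section.
  exact: conj_section_bij.
rewrite !dual_pairing_sum// (reindex_fsbig conj_section _ _ _ bij).
rewrite [RHS]mulrCA; congr (_ * _); rewrite mulrCA; congr (_ * _).
rewrite mulr_fsumr; apply: eq_fsbigr => b; rewrite inE => rb.
have /(isotropy_fiberP GE _ (dual_unitP x)) sb := rb.
have rb' : grng (val b) = dual_anchor x by case: sb.
have Db : D (grng (val b)) by rewrite rb'.
rewrite /pullback rb' [RHS]mulrCA; congr (_ * _); congr (_ * _).
have rk : grng (k (dual_anchor x)) = dual_anchor x by exact: kD.
rewrite /iso_char dual_act_char//; last first.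
  rewrite conj_sectionE// rb'; apply: (stab_conj GL); rewrite rk.
  by rewrite -rb'; exact: isotropy_stab.
rewrite conj_sectionE// rb' (gconjVK GL) ?rk//.
Qed.

End Pullback.

(** By [dual_cvg] it suffices to test compactly supported functions. Solving [act_pairing] for the
    pairing at the moved point leaves two weights, [phi] and a pairing at [x], all of which
    converge. *)
Lemma dual_act_continuous x0 : D (dual_anchor x0) ->
  (fun x => dual_act x (k (dual_anchor x)) : dual nu) @ x0 -->
  (dual_act x0 (k (dual_anchor x0)) : dual nu).
Proof.
move=> Dx0.
have [phi [phiC phi1 phiD phiK]] := bump_exists R GC GH oD Dx0.
have nD : \forall x \near x0, D (dual_anchor x).
  exact/dual_anchor_continuous/open_nbhs_nbhs.
have aC : (fun x => dual_anchor x) @ x0 --> dual_anchor x0 by exact: dual_anchor_continuous.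
have uC : (fun x => dual_unit x) @ x0 --> dual_unit x0.
  exact: (@cvg_set_type _ _ _ (nbhs x0) _ (fun x => dual_unit x) _ aC).
pose y x := dual_act x (k (dual_anchor x)) : dual nu.
have yE x : D (dual_anchor x) -> dual_anchor (y x) = gsrc (k (dual_anchor x)).
  by move=> Dx; apply: dual_act_anchor; rewrite kD.
(* The anchor of [y x] is the source of the section, so it converges before anything is known about
   [y] itself; the weight at [y x] relies on this. *)
have yC : (fun x => dual_anchor (y x)) @ x0 --> dual_anchor (y x0).
  rewrite yE//.
  have E : {near nbhs x0, (fun x => gsrc (k (dual_anchor x))) =1 (fun x => dual_anchor (y x))}.
    by near=> x; rewrite yE//; near: x.
  apply: (cvg_trans (near_eq_cvg E)).
  apply: (cvg_comp (fun x => k (dual_anchor x)) (@gsrc G)); last exact: gsrc_continuous.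
  by apply: (cvg_comp (fun x => dual_anchor x) k); [exact: aC|exact: kC].
have vC : (fun x => dual_unit (y x)) @ x0 --> dual_unit (y x0).
  exact: (@cvg_set_type _ _ _ (nbhs x0) _ (fun x => dual_unit (y x)) _ yC).
have weight_cvg (w : dual nu -> dual nu) :
    (fun x => dual_unit (w x)) @ x0 --> dual_unit (w x0) ->
    rc (haar_weight nu (dual_unit (w x))) @[x --> x0] -->
    rc (haar_weight nu (dual_unit (w x0))).
  move=> wC; have nw : \forall x \near x0, gunits A (dual_unit (w x)).
    by near=> x; exact: dual_unitP.
  exact: (haar_weight_cvg AL As AH AC rC Ai _ (dual_unitP (w x0)) nw wC).
have hC : rc (haar_weight nu (dual_unit x)) @[x --> x0] --> rc (haar_weight nu (dual_unit x0)).
  exact: (weight_cvg (fun x => x)).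
have hyC : rc (haar_weight nu (dual_unit (y x))) @[x --> x0] -->
    rc (haar_weight nu (dual_unit (y x0))).
  exact: weight_cvg.
have pC : rc (phi (dual_anchor x)) @[x --> x0] --> rc (phi (dual_anchor x0)).
  apply: (cvg_comp (fun x => phi (dual_anchor x)) (fun r => rc r));
    last exact: real_complex_continuous.
  by apply: (cvg_comp (fun x => dual_anchor x) phi); [exact: aC|exact: phiC].
apply: (@dual_cvg _ (nbhs x0) _ y (y x0)) => f Cf.
have Cf' := pullback_Cc phiC phiD phiK Cf.
have solve x : D (dual_anchor x) -> rc (phi (dual_anchor x)) != 0 ->
    dual_pairing nu (y x) f = rc (haar_weight nu (dual_unit (y x))) *
      dual_pairing nu x (pullback phi f) *
      ((rc (haar_weight nu (dual_unit x)))^-1 * (rc (phi (dual_anchor x)))^-1).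
  move=> Dx px; rewrite -(act_pairing phiC phiD phiK Dx Cf).
  have hx := weight_neq0 x.
  by rewrite mulrA mulrC -invfM mulrA mulVf ?mul1r// mulf_neq0.
have px0 : rc (phi (dual_anchor x0)) != 0 by rewrite phi1 real_complex1 oner_neq0.
have np : \forall x \near x0, rc (phi (dual_anchor x)) != 0.
  exact: (pC _ (cplx_neq0_nbhs px0)).
apply: (eq_ind_r (fun l : Cplx R => dual_pairing nu (y x) f @[x --> x0] --> l) _
  (solve x0 Dx0 px0)).
have E : {near nbhs x0, (fun x => rc (haar_weight nu (dual_unit (y x))) *
      dual_pairing nu x (pullback phi f) *
      ((rc (haar_weight nu (dual_unit x)))^-1 * (rc (phi (dual_anchor x)))^-1)) =1
    (fun x => dual_pairing nu (y x) f)}.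
  by near=> x; rewrite solve//; near: x.
apply: (cvg_trans (near_eq_cvg E)).
have fC : (fun x => dual_pairing nu x (pullback phi f)) @ x0 -->
    dual_pairing nu x0 (pullback phi f).
  exact: dual_pairing_continuous Cf' x0.
exact: (cvgM (cvgM hyC fC) (cvgM (cvgV (weight_neq0 x0) hC) (cvgV px0 pC))).
Unshelve. all: by end_near.
Qed.

End Action.

End Dual.

(** * The transformation groupoid *)

Section Transformation.
Variables (R : realType) (G : groupoid) (nu : haar_system R (isotropy G)).
Hypothesis GE : etale G.
Hypothesis GH : hausdorff_space G.
Hypothesis GC : locally_compact [set: G].
Hypothesis GA : abelian_stab G.
Hypothesis GS : continuous_stab G.
Let GT : topological_groupoid G := GE.1.
Let GL := tg_laws GT.
Let Q := orbit_groupoid G.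
Let T := trans_groupoid nu.
Implicit Types (x y : dual nu) (p q : Q) (z w v : T).

Definition orbit_act x p : dual nu := dual_act x (orbit_repr p).

Lemma orbit_act_anchor x p : dual_anchor x = orng p ->
  dual_anchor (orbit_act x p) = osrc p.
Proof. by move=> xp; apply: (dual_act_anchor GE). Qed.

Lemma orbit_act_class x (g : G) : dual_anchor x = grng g ->
  orbit_act x (orbit_class g) = dual_act x g.
Proof.
move=> xg; have [r s] := orbit_repr_class GE g.
by apply: (dual_act_eq GE) => //; rewrite ?r ?s.
Qed.

Lemma orbit_act_mul x p q : dual_anchor x = orng p -> osrc p = orng q ->
  orbit_act (orbit_act x p) q = orbit_act x (gmul p q).
Proof.
move=> xp pq; rewrite [RHS]orbit_act_class; last by rewrite grng_mul.
by rewrite /orbit_act (dual_act_mul GE).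
Qed.

(** The representative of a unit class may be a nontrivial isotropy element; commutativity makes it
    act like the unit. *)
Lemma orbit_act_unit x p : dual_anchor x = orng p -> osrc p = orng p ->
  orbit_act x p = x.
Proof.
move=> xp sp; rewrite /orbit_act.
have ux : gunits G (dual_anchor x) := char_unit (dual_charP x).
rewrite -[RHS](dual_act_unit GE x); apply: (dual_act_eq GE) => //.
  by rewrite (grng_unit GL ux).
by rewrite (gsrc_unit GL ux) xp.
Qed.

Lemma orbit_actK x p : dual_anchor x = orng p ->
  orbit_act (orbit_act x p) (ginv p) = x.
Proof.
move=> xp; have pV : osrc p = orng (ginv p) by rewrite (orngV GE).
rewrite orbit_act_mul// orbit_act_unit ?(orng_mul GE) ?(osrc_mul GE)//.
by rewrite (osrcV GE).
Qed.

Definition tchar z : dual nu := (val z).1.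
Definition torb z : Q := (val z).2.

Lemma trans_anchor z : dual_anchor (tchar z) = orng (torb z).
Proof. exact: (set_type_valP (z : set_type (trans_set (nu := nu)))). Qed.

Lemma trans_ext z w : tchar z = tchar w -> torb z = torb w -> z = w.
Proof.
move=> c o; apply: val_inj.
rewrite [val z]surjective_pairing [val w]surjective_pairing.
by congr (_, _).
Qed.

Lemma trans_compP z w : gcomp (z, w) <-> tchar w = orbit_act (tchar z) (torb z).
Proof. by []. Qed.

Lemma trans_comp_orb z w : gcomp (z, w) -> osrc (torb z) = orng (torb w).
Proof.
move=> /trans_compP E; rewrite -trans_anchor E orbit_act_anchor//.
exact: trans_anchor.
Qed.

Lemma trans_invE z : val (ginv z) = (orbit_act (tchar z) (torb z), ginv (torb z)).
Proof.
apply: val_insubd_set; rewrite /trans_set/= -/(orng _) (orngV GE).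
apply: orbit_act_anchor; exact: trans_anchor.
Qed.

Lemma trans_mulE z w : gcomp (z, w) ->
  val (gmul z w) = (tchar z, gmul (torb z) (torb w)).
Proof.
move=> zw; apply: val_insubd_set; rewrite /trans_set/= -/(orng _).
rewrite (orng_mul GE); first exact: trans_anchor.
exact: trans_comp_orb.
Qed.

Lemma tchar_inv z : tchar (ginv z) = orbit_act (tchar z) (torb z).
Proof. by rewrite /tchar trans_invE. Qed.

Lemma torb_inv z : torb (ginv z) = ginv (torb z).
Proof. by rewrite /torb trans_invE. Qed.

Lemma tchar_mul z w : gcomp (z, w) -> tchar (gmul z w) = tchar z.
Proof. by move=> zw; rewrite /tchar trans_mulE. Qed.

Lemma torb_mul z w : gcomp (z, w) -> torb (gmul z w) = gmul (torb z) (torb w).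
Proof. by move=> zw; rewrite /torb trans_mulE. Qed.

Lemma orbit_ginvK p : ginv (ginv p) = p.
Proof. by apply: (orbit_eqP GE); rewrite !(orngV GE, osrcV GE). Qed.

Lemma trans_laws : groupoid_laws T.
Proof.
have compV z : gcomp (ginv z, z).
  apply/trans_compP; rewrite tchar_inv torb_inv orbit_actK//.
  exact: trans_anchor.
have invK z : ginv (ginv z) = z.
  apply: trans_ext; rewrite ?torb_inv ?orbit_ginvK// tchar_inv torb_inv tchar_inv.
  by rewrite orbit_actK//; exact: trans_anchor.
split => //.
- move=> z w v zw wv.
  have ozw := trans_comp_orb zw; have owv := trans_comp_orb wv.
  have c1 : gcomp (gmul z w, v).
    apply/trans_compP; rewrite tchar_mul// torb_mul//.
    have /trans_compP -> := wv; have /trans_compP -> := zw.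
    by rewrite orbit_act_mul//; exact: trans_anchor.
  have c2 : gcomp (z, gmul w v) by apply/trans_compP; rewrite tchar_mul.
  split => //; apply: trans_ext; first by rewrite !tchar_mul.
  by rewrite !torb_mul// (orbit_gmulA GE).
- move=> z w zw; have ozw := trans_comp_orb zw.
  have c1 : gcomp (ginv z, gmul z w).
    by have /trans_compP := compV z; rewrite trans_compP tchar_mul.
  have wV : gcomp (w, ginv w) by have := compV (ginv w); rewrite invK.
  have c2 : gcomp (gmul z w, ginv w).
    apply/trans_compP; rewrite tchar_mul// torb_mul// tchar_inv.
    have /trans_compP -> := zw.
    by rewrite orbit_act_mul//; exact: trans_anchor.
  split; apply: trans_ext.
  + by rewrite tchar_mul// tchar_inv; have /trans_compP -> := zw.
  + rewrite torb_mul// torb_inv torb_mul//; apply: (orbit_eqP GE).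
      by rewrite (orng_mul GE) ?(orngV GE) ?(osrcV GE) ?(orng_mul GE).
    by rewrite (osrc_mul GE) ?(osrcV GE) ?(osrc_mul GE) ?(orng_mul GE).
  + by rewrite !tchar_mul.
  + rewrite torb_mul// torb_inv torb_mul//; apply: (orbit_eqP GE).
      by rewrite (orng_mul GE) ?(orng_mul GE) ?(osrc_mul GE) ?(orngV GE).
    by rewrite (osrc_mul GE) ?(osrcV GE) ?(osrc_mul GE) ?(orngV GE).
Qed.

(** * Topology of the transformation groupoid *)

Lemma tchar_continuous : continuous tchar.
Proof.
move=> z; apply: (@continuous_comp _ _ _ (val : T -> dual nu * Q) fst).
  exact: val_continuous.
exact: cvg_fst.
Qed.

Lemma torb_continuous : continuous torb.
Proof.
move=> z; apply: (@continuous_comp _ _ _ (val : T -> dual nu * Q) snd).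
  exact: val_continuous.
exact: cvg_snd.
Qed.

Lemma trans_cvg (Z : Type) (F : set_system Z) (FF : Filter F) (f : Z -> T) z :
  tchar (f t) @[t --> F] --> tchar z -> torb (f t) @[t --> F] --> torb z ->
  f @ F --> z.
Proof.
move=> c o; apply: cvg_set_type.
move=> U; rewrite [val z]surjective_pairing => -[[U1 U2] [/= n1 n2] U12].
suff : \forall t \near F, U (val (f t)) by [].
near=> t; apply: (U12 (val (f t))).
by split; near: t; [exact: c|exact: o].
Unshelve. all: by end_near.
Qed.

(** Near [z] the representative of [torb w] is exchanged for a local section evaluated at the anchor
    of [tchar w]. The result depends on [tchar w] alone, and [dual_act_continuous] applies. *)
Lemma trans_act_continuous : continuous (fun z => orbit_act (tchar z) (torb z)).
Proof.
move=> z.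
have [N [D [k [[oN Nz] [oD Du] ND DN kC]]]] := orbit_section GE GS (torb z).
have nN : \forall w \near z, N (torb w).
  exact/torb_continuous/open_nbhs_nbhs.
have loc w : N (torb w) ->
    dual_act (tchar w) (k (dual_anchor (tchar w))) = orbit_act (tchar w) (torb w).
  move=> Nw; have [Dw kw] := ND _ Nw; have [rk _] := DN _ Dw.
  by rewrite trans_anchor -[in RHS]kw orbit_act_class// rk trans_anchor.
have E : {near nbhs z, (fun w => dual_act (tchar w) (k (dual_anchor (tchar w))) : dual nu) =1
    (fun w => orbit_act (tchar w) (torb w))}.
  by near=> w; apply: loc; near: w.
apply: (cvg_trans (near_eq_cvg E)).
rewrite -loc//.
have [Dz _] := ND _ Nz.
apply: (cvg_comp tchar (fun x => dual_act x (k (dual_anchor x)) : dual nu)).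
  exact: tchar_continuous.
apply: (dual_act_continuous GE GH GC oD) => //.
- by move=> u /DN[].
- by rewrite trans_anchor.
Unshelve. all: by end_near.
Qed.

Lemma trans_topological : topological_groupoid T.
Proof.
split; first exact: trans_laws.
- move=> z; apply: (@trans_cvg _ (nbhs z) _ (@ginv T)).
    rewrite tchar_inv (_ : (fun w => tchar (ginv w)) = (fun w => orbit_act (tchar w) (torb w))).
      exact: trans_act_continuous.
    by apply/funext => w; exact: tchar_inv.
  rewrite torb_inv (_ : (fun w => torb (ginv w)) = @ginv Q \o torb).
    apply: continuous_comp; first exact: torb_continuous.
    exact: orbit_ginv_continuous.
  by apply/funext => w; exact: torb_inv.
- apply/subspace_continuousP => -[z w] zw.
  pose F := within (@gcomp T) (nbhs (z, w)).
  have c1 : (fun r : T * T => r.1) @ F --> z.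
    by apply: (cvg_trans _ (@cvg_fst _ _ (nbhs z) (nbhs w) _)); apply: cvg_app; exact: cvg_within.
  have c2 : (fun r : T * T => r.2) @ F --> w.
    by apply: (cvg_trans _ (@cvg_snd _ _ (nbhs z) (nbhs w) _)); apply: cvg_app; exact: cvg_within.
  have FC : \forall r \near F, gcomp (r.1, r.2).
    by apply: (filterS (P := @gcomp T)); [case|exact: withinT].
  apply: (@trans_cvg _ F _ (fun r : T * T => gmul r.1 r.2) (gmul z w)).
    rewrite tchar_mul//.
    have E : {near F, (fun r : T * T => tchar r.1) =1 (fun r => tchar (gmul r.1 r.2))}.
      by near=> r; rewrite tchar_mul//; near: r; exact: FC.
    apply: (cvg_trans (near_eq_cvg E)).
    by apply: (cvg_comp (fun r : T * T => r.1) tchar); [exact: c1|exact: tchar_continuous].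
  rewrite torb_mul//.
  have E : {near F, (fun r : T * T => gmul (torb r.1) (torb r.2)) =1
      (fun r => torb (gmul r.1 r.2))}.
    by near=> r; rewrite torb_mul//; near: r; exact: FC.
  apply: (cvg_trans (near_eq_cvg E)).
  apply: (orbit_gmul_cvg GE GS).
  + by apply: (cvg_comp (fun r : T * T => r.1) torb); [exact: c1|exact: torb_continuous].
  + by apply: (cvg_comp (fun r : T * T => r.2) torb); [exact: c2|exact: torb_continuous].
  + by near=> r; apply: trans_comp_orb; near: r; exact: FC.
  + exact: trans_comp_orb.
Unshelve. all: by end_near.
Qed.

Lemma trans_compgV z : gcomp (z, ginv z).
Proof. exact: gcompgV trans_laws z. Qed.

Lemma trans_compVg z : gcomp (ginv z, z).
Proof. exact: gcompV trans_laws z. Qed.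

Lemma tchar_rng z : tchar (grng z) = tchar z.
Proof. exact: (tchar_mul (trans_compgV z)). Qed.

Lemma torb_rng z : torb (grng z) = grng (torb z).
Proof. by rewrite (torb_mul (trans_compgV z)) torb_inv. Qed.

Lemma torb_src z : torb (gsrc z) = gsrc (torb z).
Proof. by rewrite (torb_mul (trans_compVg z)) torb_inv. Qed.

Lemma trans_unitP z : gunits T z <-> gunits Q (torb z).
Proof.
split=> [[w _ <-]|]; first by rewrite torb_rng; exists (torb w).
move=> /(orbit_gunitsP GE) E; apply/(gunitsP trans_laws); apply: trans_ext.
  exact: tchar_rng.
by rewrite torb_rng (orbit_grng GE).
Qed.

Lemma trans_range_local_homeo : range_local_homeo T.
Proof.
move=> z.
have [N [D [k [[oN Nz] [oD Du] ND DN kC]]]] := orbit_section GE GS (torb z).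
(* The inverse of the range keeps the character and rebuilds the class from its range by [k]; the
   default [w] can occur only when the range is outside [D]. *)
pose kk w : T := insubd w (tchar w, orbit_class (k (orng (torb w)))).
have kkE w : D (orng (torb w)) -> val (kk w) = (tchar w, orbit_class (k (orng (torb w)))).
  move=> Dw; apply: val_insubd_set; rewrite /trans_set/= -/(orng _) (orng_class GE).
  by have [-> _] := DN _ Dw; exact: trans_anchor.
have kk1 w : D (orng (torb w)) -> tchar (kk w) = tchar w.
  by move=> Dw; rewrite /tchar kkE.
have kk2 w : D (orng (torb w)) -> torb (kk w) = orbit_class (k (orng (torb w))).
  by move=> Dw; rewrite /torb kkE.
have orng_rng w : orng (torb (grng w)) = orng (torb w).
  by rewrite torb_rng (orbit_grng GE) (orng_class GE) grng_rng.
have otC : continuous (fun w => orng (torb w)).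
  move=> w; apply: (@continuous_comp _ _ _ torb (@orng G)); first exact: torb_continuous.
  exact: orng_continuous.
have imE : @grng T @` (torb @^-1` N) = (fun w => orng (torb w)) @^-1` D `&` gunits T.
  apply/seteqP; split=> [_ [w Nw <-]|w [Dw uw]].
    by split; [rewrite /= orng_rng; case: (ND _ Nw)|exists w].
  exists (kk w); first by rewrite /= kk2//; case: (DN _ Dw).
  apply: trans_ext; first by rewrite tchar_rng kk1.
  rewrite torb_rng kk2// (orbit_grng GE) (orng_class GE).
  have [-> _] := DN _ Dw.
  by move: uw => /trans_unitP /(orbit_gunitsP GE).
exists (torb @^-1` N); split.
- by apply: open_comp => // w _; exact: torb_continuous.
- exact: Nz.
- exists ((fun w => orng (torb w)) @^-1` D) => //.
  by apply: open_comp => // w _; exact: otC.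
- by apply: continuous_subspaceT; exact: grng_continuous trans_topological.
- exists kk; split; last first.
    move=> h Nh; have [Dh kh] := ND _ Nh.
    have Dr : D (orng (torb (grng h))) by rewrite orng_rng.
    apply: trans_ext; first by rewrite kk1// tchar_rng.
    by rewrite kk2// orng_rng.
  apply: continuous_in_subspaceT => w; rewrite inE imE => -[Dw _].
  have nD : \forall v \near w, D (orng (torb v)).
    exact: (otC w _ (open_nbhs_nbhs (conj oD Dw))).
  apply: (@trans_cvg _ (nbhs w) _ kk (kk w)).
    rewrite kk1//.
    have E : {near nbhs w, tchar =1 (fun v => tchar (kk v))}.
      by near=> v; rewrite kk1//; near: v.
    by apply: (cvg_trans (near_eq_cvg E)); exact: tchar_continuous.
  rewrite kk2//.
  have E : {near nbhs w, (fun v => orbit_class (k (orng (torb v)))) =1 (fun v => torb (kk v))}.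
    by near=> v; rewrite kk2//; near: v.
  apply: (cvg_trans (near_eq_cvg E)).
  apply: (cvg_comp (fun v => k (orng (torb v))) (@orbit_class G));
    last exact: orbit_class_continuous.
  by apply: (cvg_comp (fun v => orng (torb v)) k); [exact: otC|exact: kC].
Unshelve. all: by end_near.
Qed.

Lemma trans_etale : etale T.
Proof. by split; [exact: trans_topological|exact: trans_range_local_homeo]. Qed.

Lemma trans_hausdorff : hausdorff_space T.
Proof.
move=> z w zw; apply: trans_ext.
  apply: (dual_hausdorff GE GH GC) => U V nU nV.
  have [v [vU vV]] := zw _ _ (tchar_continuous nU) (tchar_continuous nV).
  by exists (tchar v).
apply: (orbit_hausdorff GE GH) => U V nU nV.
have [v [vU vV]] := zw _ _ (torb_continuous nU) (torb_continuous nV).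
by exists (torb v).
Qed.

Lemma closed_trans_set : closed (trans_set (nu := nu)).
Proof.
apply: (closed_eq (f := fun t : dual nu * Q => dual_anchor t.1) (g := fun t => orng t.2)) => // t.
- apply: (@continuous_comp _ _ _ fst (fun x : dual nu => dual_anchor x)); first exact: cvg_fst.
  exact: (dual_anchor_continuous GE GH GC).
- apply: (@continuous_comp _ _ _ snd (@orng G)); first exact: cvg_snd.
  exact: orng_continuous.
Qed.

(** Together with [tchar_mul] and the formulas for inverses, this shows that arrows with both end
    characters in a fixed set form a subgroupoid. *)
Lemma trans_act_mul z w : gcomp (z, w) ->
  orbit_act (tchar (gmul z w)) (torb (gmul z w)) = orbit_act (tchar w) (torb w).
Proof.
move=> zw; rewrite tchar_mul// torb_mul// -orbit_act_mul ?trans_anchor//.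
  by have /trans_compP <- := zw.
exact: trans_comp_orb.
Qed.

Lemma trans_act_inv z : orbit_act (tchar (ginv z)) (torb (ginv z)) = tchar z.
Proof. by rewrite tchar_inv torb_inv orbit_actK// trans_anchor. Qed.

(* Only the characters met by the closure of [V] matter: they form a compact set [B],
   and reducing the preimage of a precompact subgroupoid of the orbit groupoid to [B]
   makes it precompact, without knowing that the anchor map is proper. *)
Lemma trans_dad_bound d : dad_bound Q d -> dad_bound T d.
Proof.
move=> dadQ V oV pV.
have CK : compact (closure V) by rewrite -precompactE.
(* The bound on the orbit groupoid concerns open precompact sets, so it is applied to such a
   neighbourhood [W] of the compact image of [closure V]. *)
have [|W [oW pW CW]] := orbit_precompact_cover GE GS GH GC (C := torb @` closure V).
  apply: continuous_compact => //.
  by apply: continuous_subspaceT; exact: torb_continuous.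
have VW z : V z -> W (torb z).
  by move=> Vz; apply: CW; exists z => //; exact: subset_closure.
have [U [oU covU KU]] := dadQ W oW pW.
exists (fun i => torb @^-1` U i `&` gunits T); split.
- move=> i; have [P oP UE] := oU i.
  exists (torb @^-1` P); first by apply: open_comp => // z _; exact: torb_continuous.
  apply/seteqP; split=> z [/=].
    by rewrite UE => -[].
  by move=> Pz uz; split => //=; rewrite UE; split => //; exact/trans_unitP.
- move=> _ [[z Vz <-]|[z Vz <-]].
    have [|i _ Ui] := covU (gsrc (torb z)); first by left; exists (torb z) => //; exact: VW.
    by exists i => //; split; [rewrite /= torb_src|exact: gunits_src trans_laws z].
  have [|i _ Ui] := covU (grng (torb z)); first by right; exists (torb z) => //; exact: VW.
  by exists i => //; split; [rewrite /= torb_rng|exact: gunits_rng].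
- move=> i; have [K [[KM KV] pK UK]] := KU i.
  pose act z := orbit_act (tchar z) (torb z).
  pose B := tchar @` closure V `|` act @` closure V.
  have BK : compact B.
    by apply: compactU; apply: continuous_compact => //; apply: continuous_subspaceT;
      [exact: tchar_continuous|exact: trans_act_continuous].
  exists [set z | [/\ B (tchar z), B (act z) & K (torb z)]]; split.
  + split=> [z w [Bz Baz Kz] [Bw Baw Kw] zw|z [Bz Baz Kz]]; split.
    * by rewrite tchar_mul.
    * by rewrite /act trans_act_mul.
    * rewrite torb_mul//; apply: KM => //.
      by apply/(gcompP GL); exact: trans_comp_orb zw.
    * by rewrite tchar_inv.
    * by rewrite /act trans_act_inv.
    * by rewrite torb_inv; exact: KV.
  + have EK : compact (val @^-1` (B `*` closure K) : set T).
      apply: compact_set_type; apply: compact_closedI; last exact: closed_trans_set.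
      by apply: compact_setX => //; rewrite -precompactE.
    exists (val @^-1` (B `*` closure K) : set T).
      by move=> z [Bz _ Kz]; split => //=; exact: subset_closure.
    by split; [exact: EK|exact: (compact_closed trans_hausdorff EK)].
  + move=> z [Vz [Us _] [Ur _]]; split.
    * by left; exists z => //; exact: subset_closure.
    * by right; exists z => //; exact: subset_closure.
    * by apply: UK; split; [exact: VW|rewrite -torb_src|rewrite -torb_rng].
Qed.

End Transformation.

(** [dad] is a least bound; in this form the statement on dimensions reduces to transferring the
    bound at one and the same [n]. *)
Lemma dad_leP (G : groupoid) (d : nat) :
  dad_le G d <-> exists2 n, (n <= d)%N & dad_bound G n.
Proof.
rewrite /dad_le /dad; case: pselect => [e|ne].
  case: ex_minnP => m /asboolP mb mmin; split=> [md|[n nd nb]]; first by exists m.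
  by apply: leq_trans nd; apply: mmin; exact/asboolP.
by split=> // -[n _ nb]; apply: ne; exists n; exact/asboolP.
Qed.

Theorem corollary5p4 (R : realType) (G : groupoid)
    (G_second_countable : @second_countable G)
    (G_locally_compact : locally_compact [set: G])
    (G_hausdorff : hausdorff_space G)
    (G_etale : etale G)
    (G_abelian : abelian_stab G)
    (G_continuous : continuous_stab G)
    (nu : haar_system R (isotropy G)) :
  etale (trans_groupoid nu) /\
  forall d : nat, dad_le (orbit_groupoid G) d -> dad_le (trans_groupoid nu) d.
Proof.
split; first exact: trans_etale.
move=> d /dad_leP[n nd dadn]; apply/dad_leP; exists n => //.
exact: trans_dad_bound.
Qed.
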